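(* Let $\mathbb V$ be a Schubert representation of $\widehat H_n$ with equivariant parameters $t_1,\dots,t_n$. For $1\le i\le k$ let $R_i$ be the $\mathbb F$-linear operator on the span of $\{\mathcal Y_\nu:\nu\subseteq(n-k)^k\}$ given by $$R_i(\mathcal Y_\nu)=t_{\nu_i+k+1-i}\,\mathcal Y_\nu+\sum_\mu\bigl(\hbar-(p-q)t_{\mathtt h(\mu/\nu)}\bigr)p^{\operatorname{ht}(\mu/\nu)-1}q^{\operatorname{wd}(\mu/\nu)-1}\,\mathcal Y_\mu,$$ the sum over $\mu\subseteq(n-k)^k$ such that $\mu/\nu$ is a ribbon with head in row $i$. Then for $\lambda\subseteq(n-k)^k$ and $0\le r\le k$, $$e_r(x_1,\dots,x_k)\cdot\mathcal Y_\lambda=\sum_{1\le i_1<\cdots<i_r\le k}R_{i_r}\cdots R_{i_1}(\mathcal Y_\lambda).$$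
   Context: $\widehat H_n$: the $\mathbb Q[p,q,\hbar]$-algebra generated by $T_1,\dots,T_{n-1},x_1,\dots,x_n$ with $(T_i+p)(T_i-q)=0$, braid relations, $x_ix_j=x_jx_i$, $T_ix_j=x_jT_i$ ($j\ne i,i+1$), $T_ix_i=x_{i+1}T_i+(\hbar-(p-q)x_i)$, $T_ix_{i+1}=x_iT_i-(\hbar-(p-q)x_i)$; $T_w$ via reduced words. Schubert representation: field $\mathbb F$ with $t_1,\dots,t_n\in\mathbb F$, ring map $\mathbb Q[p,q,\hbar]\to\mathbb F$, $\mathbb F$-space $\mathbb V$ with $\widehat H_n$-action, basis $\mathcal Y_w=T_{w^{-1}w_0}\mathcal Y_{w_0}$ ($w_0$ longest), and $\mathbb F$-linear $\operatorname{ev}$ with $\operatorname{ev}(\mathcal Y_w)\ne0\iff w=\mathrm{id}$, $\operatorname{ev}(x_i\mathcal Y_w)=t_i\operatorname{ev}(\mathcal Y_w)$. For $\nu\subseteq(n-k)^k$ ($n-k\ge\nu_1\ge\dots\ge\nu_k\ge0$), $w_\nu$ is given by $w_\nu(k+1-i)=\nu_i+k+1-i$ ($1\le i\le k$), increasing on $\{k+1,\dots,n\}$, and $\mathcal Y_\nu=\sum_{v\in S_k\times S_{n-k}}p^{\ell(v)}\mathcal Y_{w_\nu v}$. Ribbon: nonempty connected skew shape $\eta=\mu/\nu$ with no $2\times2$ square (Young diagrams, rows top to bottom); head = top-right box; $\operatorname{ht},\operatorname{wd}$ = numbers of rows, columns; if the head is in row $i$, $\mathtt h(\eta)=\mu_i+k+1-i$.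 *)

(* Defs.v *)
From HB Require Import structures.
From mathcomp Require Import all_boot all_order all_algebra all_fingroup.
Set Implicit Arguments. Unset Strict Implicit. Unset Printing Implicit Defensive.
Import Order.TTheory GRing.Theory Num.Theory.
Local Open Scope ring_scope.

(* Conventions: operators T_i (1 <= i <= n-1), x_i, t_i (1 <= i <= n), rows of
   partitions i (1 <= i <= k) are indexed 1-based by nat as in the paper.
   Permutations are elements of 'S_n acting on 'I_n = {0,..,n-1}; the paper's
   value j in {1..n} corresponds to the ordinal j-1.  MathComp's product is
   (s * t) x = t (s x), so the composition  w o v  is written (v * w)%g. *)

Section Defs.
Variable F : fieldType.
Variable V : lmodType F.

Definition lin (f : V -> V) : Prop :=
  forall (a : F) (u v : V), f (a *: u + v) = a *: f u + f v.

(* 1-based one-line notation: pw w j = w(j) for 1 <= j <= n *)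
Definition pw n (w : 'S_n) (j : nat) : nat :=
  (oapp (fun i : 'I_n => nat_of_ord (w i)) j.-1 (insub j.-1 : option 'I_n)).+1.

Definition perm_length n (w : 'S_n) : nat :=
  #|[set ab : 'I_n * 'I_n | (ab.1 < ab.2)%N && (w ab.2 < w ab.1)%N]|.

Definition w0 n : 'S_n := perm (@rev_ord_inj n).

(* simple transposition s_a = (a, a+1), 1 <= a <= n-1 *)
Definition sref n (a : nat) : 'S_n :=
  match (insub a.-1 : option 'I_n), (insub a : option 'I_n) with
  | Some i, Some j => tperm i j
  | _, _ => 1%g
  end.

(* word_perm [:: a1; ...; al] = s_a1 o s_a2 o ... o s_al *)
Fixpoint word_perm n (s : seq nat) : 'S_n :=
  if s is a :: s' then (word_perm n s' * sref n a)%g else 1%g.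

Definition reduced_word n (s : seq nat) (w : 'S_n) : bool :=
  all (fun a => (0 < a < n)%N) s && (word_perm n s == w) && (size s == perm_length w).

Definition T_word (T : nat -> V -> V) (s : seq nat) (v : V) : V :=
  foldr (fun a u => T a u) v s.

Record schubert_rep n (p q hbar : F) (t : nat -> F) (T x : nat -> V -> V)
    (Y : 'S_n -> V) (ev : V -> F) : Prop := SchubertRep {
  T_lin : forall i, (0 < i < n)%N -> lin (T i);
  x_lin : forall i, (0 < i <= n)%N -> lin (x i);
  T_quad : forall i, (0 < i < n)%N -> forall v,
      T i (T i v) + (p - q) *: T i v - (p * q) *: v = 0;
  T_braid : forall i, (0 < i)%N -> (i.+1 < n)%N -> forall v,
      T i (T i.+1 (T i v)) = T i.+1 (T i (T i.+1 v));
  T_far : forall i j, (0 < i < n)%N -> (0 < j < n)%N -> (i.+1 < j)%N -> forall v,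
      T i (T j v) = T j (T i v);
  x_comm : forall i j, (0 < i <= n)%N -> (0 < j <= n)%N -> forall v,
      x i (x j v) = x j (x i v);
  Tx_comm : forall i j, (0 < i < n)%N -> (0 < j <= n)%N -> j <> i -> j <> i.+1 ->
      forall v, T i (x j v) = x j (T i v);
  Tx_i : forall i, (0 < i < n)%N -> forall v,
      T i (x i v) = x i.+1 (T i v) + (hbar *: v - (p - q) *: x i v);
  Tx_i1 : forall i, (0 < i < n)%N -> forall v,
      T i (x i.+1 v) = x i (T i v) - (hbar *: v - (p - q) *: x i v);
  Y_free : forall c : 'S_n -> F, \sum_(w : 'S_n) c w *: Y w = 0 -> forall w, c w = 0;
  Y_span : forall v : V, exists c : 'S_n -> F, v = \sum_(w : 'S_n) c w *: Y w;
  (* Y_w = T_{w^{-1} w0} Y_{w0}, w^{-1} w0 = w^{-1} o w0 *)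
  Y_def : forall (w : 'S_n) (s : seq nat),
      reduced_word s (w0 n * w^-1)%g -> Y w = T_word T s (Y (w0 n));
  ev_lin : forall (a : F) (u v : V), ev (a *: u + v) = a * ev u + ev v;
  ev_Y : forall w : 'S_n, ev (Y w) <> 0 <-> w = 1%g;
  ev_x : forall i, (0 < i <= n)%N -> forall w : 'S_n, ev (x i (Y w)) = t i * ev (Y w)
}.

Definition part n k := {ffun 'I_k -> 'I_(n - k).+1}.

Definition is_part n k (nu : part n k) : bool :=
  [forall i : 'I_k, forall j : 'I_k, (i <= j)%N ==> (nu j <= nu i)%N].

(* nu_i, 1-based row index (0 outside 1..k) *)
Definition prow n k (nu : part n k) (i : nat) : nat :=
  oapp (fun r : 'I_k => nat_of_ord (nu r)) 0%N (insub i.-1 : option 'I_k).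

(* w_nu (k+1-i) = nu_i + k+1-i, increasing on {k+1..n} *)
Definition is_wnu n k (nu : part n k) (w : 'S_n) : bool :=
  [forall i : 'I_k, pw w (k - i) == (nu i + (k - i))%N] &&
  [forall a : 'I_n, forall b : 'I_n, ((k <= a)%N && (a < b)%N) ==> (w a < w b)%N].

Definition wnu n k (nu : part n k) : 'S_n := odflt 1%g [pick w | is_wnu nu w].

(* v in S_k x S_{n-k} *)
Definition young n k (v : 'S_n) : bool := [forall a : 'I_n, (a < k)%N == (v a < k)%N].

Definition Ynu n k (p : F) (Y : 'S_n -> V) (nu : part n k) : V :=
  \sum_(v : 'S_n | young k v) (p ^+ perm_length v) *: Y (v * wnu nu)%g.

Definition inB n k (nu mu : part n k) (r c : nat) : bool :=
  (0 < r <= k)%N && (prow nu r < c)%N && (c <= prow mu r)%N.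

Definition cell_in n k (nu mu : part n k) (z : 'I_k * 'I_(n - k)) : bool :=
  inB nu mu (z.1).+1 (z.2).+1.

Definition adj n k (z z' : 'I_k * 'I_(n - k)) : bool :=
  ((nat_of_ord z.1 == z'.1) && (((z.2).+1 == z'.2 :> nat) || ((z'.2).+1 == z.2 :> nat))) ||
  ((nat_of_ord z.2 == z'.2) && (((z.1).+1 == z'.1 :> nat) || ((z'.1).+1 == z.1 :> nat))).

Definition is_ribbon n k (nu mu : part n k) : bool :=
  [&& [forall i : 'I_k, (nu i <= mu i)%N],
      [exists z, cell_in nu mu z],
      [forall z, forall z', (cell_in nu mu z && cell_in nu mu z') ==>
          connect [rel a b | [&& cell_in nu mu a, cell_in nu mu b & adj a b]] z z'] &
      ~~ [exists z : 'I_k * 'I_(n - k),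
           let r := (z.1).+1 in let c := (z.2).+1 in
           [&& inB nu mu r c, inB nu mu r.+1 c, inB nu mu r c.+1 & inB nu mu r.+1 c.+1]]].

Definition has_box n k (nu mu : part n k) (r : nat) : bool :=
  [exists c : 'I_(n - k), inB nu mu r c.+1].

(* the head (top-right box) of mu/nu lies in row i, i.e. row i is the topmost
   nonempty row *)
Definition head_in n k (nu mu : part n k) (i : nat) : bool :=
  has_box nu mu i && [forall j : 'I_k, (j.+1 < i)%N ==> ~~ has_box nu mu j.+1].

Definition ht n k (nu mu : part n k) : nat := #|[set r : 'I_k | has_box nu mu r.+1]|.
Definition wd n k (nu mu : part n k) : nat :=
  #|[set c : 'I_(n - k) | [exists r : 'I_k, inB nu mu r.+1 c.+1]]|.

Definition R_val n k (p q hbar : F) (t : nat -> F) (Y : 'S_n -> V) (i : nat)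
    (nu : part n k) : V :=
  t (prow nu i + k.+1 - i)%N *: Ynu p Y nu +
  \sum_(mu : part n k | [&& is_part mu, is_ribbon nu mu & head_in nu mu i])
     ((hbar - (p - q) * t (prow mu i + k.+1 - i)%N)
        * p ^+ (ht nu mu).-1 * q ^+ (wd nu mu).-1) *: Ynu p Y mu.

Definition esym_apply (f : nat -> V -> V) (k r : nat) (v : V) : V :=
  \sum_(S : {set 'I_k} | #|S| == r)
     foldl (fun u i => f i u) v [seq (nat_of_ord j).+1 | j <- enum S].

End Defs.

(* Main.v *)
(** Since [x_i Y_(w0) = t_(n+1-i) Y_(w0)] (the functionals [ev o T_w] separate points), the
    module is determined by moving the [x_i] to the right through products of the [T_i].

    A partition [nu] is encoded by the bit string whose ones are the numbers
    [nu_i + k + 1 - i], read from [n] down to 1: [k] particles on [n] sites.  [R_i] moves a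
    particle, with weight [p] (resp. [q]) for each particle (resp. hole) it crosses, onto a
    hole just before the [i]-th particle of the string.  Composing, the product of the
    [1 + z R_i] becomes a transfer matrix that scans the sites once and whose auxiliary state
    is the number [m] of jumps that have landed but whose source is still to be met.

    On the other side [prod (1 + z x_i)] commutes with the symmetrizer defining [Y_nu].
    Moving it through a word taking the extreme configuration to the one of [nu], one letter
    at a time, reproduces the same transfer matrix: this is a two-site exchange relation, with
    the site variable [x_i] in place of [t].  Comparing coefficients of [z] concludes. *)

Require Import Defs.
From HB Require Import structures.
From mathcomp Require Import all_boot all_order all_algebra all_fingroup zify ring.
Import GRing.Theory.
Local Open Scope ring_scope.

Set Implicit Arguments. Unset Strict Implicit. Unset Printing Implicit Defensive.

(** The [x i] are not diagonal on the vectors [Y_nu], so a recursion on these vectors alone does not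
    close. Each [Y_nu] is therefore kept as an operator applied to a free vector [u]: the claim for
    a string with [01] at [u] reduces to the claim with [10] at [T u], and the identity is proved
    for all [u] with operators at the sites. Only at [u = Y (w0 n)], a common eigenvector, do these
    become the scalars [t]. The exchange relation works because one expression, [hbar - (p - q) x],
    is both the correction when [x_i] passes [T_i] and the weight of a landing in [R_i]. The weights
    [p^l(v)] in [Y_nu] serve to make [T_i] act by [q] at two equal neighbouring bits, which the
    exchange requires. The parameter [z] is a scalar of the field, not an indeterminate;
    characteristic zero provides enough values of it. *)

Local Notation ones := (count id).
Local Notation zeros := (count negb).

(** * Lengths and reduced words *)

Section Permutations.
Variable n : nat.
Implicit Types (w : 'S_n) (i j : 'I_n) (s : seq nat).

Lemma srefE i j : j = i.+1 :> nat -> sref n j = tperm i j.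
Proof.
move=> ji; rewrite /sref.
have -> : (nat_of_ord j).-1 = i by rewrite ji.
by rewrite !valK.
Qed.

Lemma letterP a : (0 < a < n)%N -> exists i j, a = j /\ j = i.+1 :> nat.
Proof.
case: a => [|a] //= an.
by exists (Ordinal (ltnW an)), (Ordinal an).
Qed.

Lemma sref_invol a : (sref n a * sref n a = 1)%g.
Proof.
rewrite /sref; case: insub => [i|]; last by rewrite mulg1.
by case: insub => [j|]; rewrite ?mulg1 // tperm2.
Qed.

Lemma srefV a : (sref n a)^-1%g = sref n a.
Proof. by apply/eqP; rewrite eq_invg_mul sref_invol. Qed.

(** Relabelling pairs by the transposition carries the inversions of [w] to those of the product,
    and [(i, j)] is the only new one. *)
Lemma length_sref_mul w i j : j = i.+1 :> nat -> (w i < w j)%N ->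
  perm_length (sref n j * w)%g = (perm_length w).+1.
Proof.
move=> ji wij; rewrite (srefE ji) /perm_length.
set s := tperm i j.
pose f (ab : 'I_n * 'I_n) := (s ab.1, s ab.2).
have ss x : s (s x) = x by rewrite /s tpermK.
have f_inj : injective f.
  move=> [a b] [c d] [] /perm_inj -> /perm_inj -> //.
have sord (a b : 'I_n) : (a < b)%N -> (a, b) != (i, j) -> (s a < s b)%N.
  move=> ab; rewrite xpair_eqE negb_and -!val_eqE /= => ne.
  rewrite /s; case: tpermP => [/(congr1 val) /= ?|/(congr1 val) /= ?|/eqP + /eqP +];
  case: tpermP => [/(congr1 val) /= ?|/(congr1 val) /= ?|/eqP + /eqP +];
  rewrite -?val_eqE /=; lia.
set A := [set ab | _]; set B := [set ab | _ && (w _ < _)%N].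
have -> : A = (i, j) |: f @: B.
  apply/setP => -[a b]; rewrite !inE /=.
  apply/andP/orP => [[ab]|].
    rewrite !permM => wab.
    have [->|ne] := eqVneq (a, b) (i, j); [by left|right].
    apply/imsetP; exists (s a, s b); last by rewrite /f /= !ss.
    by rewrite inE /= (sord _ _ ab ne).
  case=> [/eqP [-> ->]|/imsetP [[c d]]].
    by rewrite !permM tpermL tpermR wij; lia.
  rewrite inE /= => /andP [cd wcd] [-> ->].
  rewrite !permM !ss wcd; split=> //.
  by apply: sord => //; apply/eqP => -[ci dj]; move: wcd; rewrite ci dj; lia.
rewrite cardsU1 card_imset //.
suff -> : (i, j) \notin f @: B by [].
apply/imsetP => -[[c d]]; rewrite inE /= => /andP [cd _] [ic jd].
have : c = j by rewrite -(ss c) -ic /s tpermL.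
have : d = i by rewrite -(ss d) -jd /s tpermR.
by move=> di cj; move: cd; rewrite di cj; lia.
Qed.

Lemma length_inv w : perm_length w^-1%g = perm_length w.
Proof.
pose f (ab : 'I_n * 'I_n) := (w ab.2, w ab.1).
have f_inj : injective f by move=> [a b] [c d] [] /perm_inj -> /perm_inj ->.
rewrite /perm_length -[RHS](card_imset _ f_inj); congr #|pred_of_set _|.
apply/setP => -[a b]; rewrite !inE /=; apply/idP/imsetP => [/andP [ab wab]|].
  by exists (w^-1%g b, w^-1%g a); rewrite ?inE /f /= ?permKV // ab wab.
move=> [[c d]]; rewrite inE /= => /andP [cd wcd] [-> ->].
by rewrite !permK cd wcd.
Qed.

Lemma length_mul_sref w i j : j = i.+1 :> nat -> (w^-1%g i < w^-1%g j)%N ->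
  perm_length (w * sref n j)%g = (perm_length w).+1.
Proof.
move=> ji wij; rewrite -length_inv invMg srefV (length_sref_mul ji) //.
by rewrite length_inv.
Qed.

Lemma sref_mulE w i j : j = i.+1 :> nat ->
  ((sref n j * w)%g i = w j) * ((sref n j * w)%g j = w i).
Proof. by move=> ji; rewrite (srefE ji) !permM tpermL tpermR. Qed.

Lemma mul_srefE w i j : j = i.+1 :> nat ->
  ((w * sref n j)^-1%g i = w^-1%g j) * ((w * sref n j)^-1%g j = w^-1%g i).
Proof. by move=> ji; rewrite invMg srefV; apply: sref_mulE. Qed.

Lemma length_sref_mul_desc w i j : j = i.+1 :> nat -> (w j < w i)%N ->
  perm_length w = (perm_length (sref n j * w)%g).+1.
Proof.
move=> ji wji; rewrite -(@length_sref_mul (sref n j * w)%g i j ji).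
  by rewrite mulgA sref_invol mul1g.
by have [-> ->] := sref_mulE w ji.
Qed.

Lemma length_mul_sref_desc w i j : j = i.+1 :> nat -> (w^-1%g j < w^-1%g i)%N ->
  perm_length w = (perm_length (w * sref n j)%g).+1.
Proof.
move=> ji wji; rewrite -(@length_mul_sref (w * sref n j)%g i j ji).
  by rewrite -mulgA sref_invol mulg1.
by have [-> ->] := mul_srefE w ji.
Qed.

Lemma perm_neq_lt w i j : i != j -> ~~ (w i < w j)%N -> (w j < w i)%N.
Proof.
move=> ij; rewrite -leqNgt leq_eqVlt => /orP [/eqP/val_inj/perm_inj E|//].
by rewrite E eqxx in ij.
Qed.

Lemma adj_neq i j : j = i.+1 :> nat -> i != j.
Proof. by move=> ji; apply/eqP => E; move: ji; rewrite E; lia. Qed.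

(** Strict growth forces [i <= w i] climbing from 0, and [w i <= i] descending from the top. *)
Lemma increasing_perm1 w :
  (forall i j, j = i.+1 :> nat -> (w i < w j)%N) -> w = 1%g.
Proof.
move=> inc.
have ge d i : (nat_of_ord i <= d)%N -> (i <= w i)%N.
  elim: d i => [|d IH] i; first by rewrite leqn0 => /eqP ->.
  case: i => [[|a] an] //= ad.
  have := inc (Ordinal (ltnW an)) (Ordinal an) erefl.
  by have := IH (Ordinal (ltnW an)) ad; rewrite /=; lia.
have le d i : (n - i <= d)%N -> (w i <= i)%N.
  elim: d i => [|d IH] i; first by have := ltn_ord i; lia.
  move=> nd; have [an|an] := ltnP i.+1 n.
    have := inc i (Ordinal an) erefl.
    by have := IH (Ordinal an); rewrite /=; lia.
  by have := ltn_ord (w i); lia.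
apply/permP => i; rewrite perm1; apply: val_inj; apply/eqP.
by rewrite eqn_leq (le _ _ (leqnn _)) (ge _ _ (leqnn _)).
Qed.

Lemma exists_desc w : w != 1%g -> exists i j, j = i.+1 :> nat /\ (w j < w i)%N.
Proof.
move=> w1; have [/existsP [i /existsP [j /andP [/eqP ji wd]]]|H] :=
  boolP [exists i : 'I_n, exists j : 'I_n, (nat_of_ord j == i.+1) && (w j < w i)%N].
  by exists i, j.
case/eqP: w1; apply: increasing_perm1 => i j ji.
move: H; rewrite negb_exists => /forallP /(_ i).
rewrite negb_exists => /forallP /(_ j); rewrite ji eqxx /=.
by apply: perm_neq_lt; rewrite eq_sym adj_neq.
Qed.

Lemma length1 : perm_length (1%g : 'S_n) = 0%N.
Proof.
apply/eqP; rewrite cards_eq0; apply/eqP/setP => -[a b].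
by rewrite !inE /= !perm1; lia.
Qed.

Lemma length_le_w0 w : (perm_length w <= perm_length (w0 n))%N.
Proof.
apply/subset_leq_card/subsetP => -[a b]; rewrite !inE /= => /andP [ab _].
by rewrite ab !permE /=; have := ltn_ord b; lia.
Qed.

Lemma w0_invol : (w0 n * w0 n = 1)%g.
Proof. by apply/permP => a; rewrite permM perm1 !permE rev_ordK. Qed.

Lemma w0V : (w0 n)^-1%g = w0 n.
Proof. by apply/eqP; rewrite eq_invg_mul w0_invol. Qed.

Lemma word_perm_cat s s' : word_perm n (s ++ s') = (word_perm n s' * word_perm n s)%g.
Proof. by elim: s => [|a s IH] /=; rewrite ?mulg1 // IH mulgA. Qed.

Lemma length_word_le s :
  all (fun a => (0 < a < n)%N) s -> (perm_length (word_perm n s) <= size s)%N.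
Proof.
elim: s => [|a s IH] /=; first by rewrite length1.
case/andP=> /letterP [i [j [-> ji]]] /IH.
set w := word_perm n s => le.
have [lt|/(perm_neq_lt (adj_neq ji)) gt] := boolP (w^-1%g i < w^-1%g j)%N.
  by rewrite (length_mul_sref ji).
by move: le; rewrite (length_mul_sref_desc ji gt); lia.
Qed.

Lemma reduced_cons w i j s : j = i.+1 :> nat -> (w^-1%g j < w^-1%g i)%N ->
  reduced_word s (w * sref n j)%g -> reduced_word (nat_of_ord j :: s) w.
Proof.
move=> ji d; rewrite /reduced_word /= => /andP [/andP [al /eqP Ew] /eqP sz].
rewrite al ltn_ord ji /= -ji Ew -mulgA sref_invol mulg1 eqxx /=.
by rewrite (length_mul_sref_desc ji d) sz.
Qed.

Lemma reduced_consE w (a : nat) s : reduced_word (a :: s) w ->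
  exists i j, [/\ a = j, j = i.+1 :> nat, (w^-1%g j < w^-1%g i)%N
                & reduced_word s (w * sref n j)%g].
Proof.
rewrite /reduced_word /= => /andP [/andP [/andP [an al] /eqP Ew] /eqP sz].
have [i [j [aj ji]]] := letterP an; exists i, j; subst a.
have Es : word_perm n s = (w * sref n j)%g by rewrite -Ew -mulgA sref_invol mulg1.
have le := length_word_le al; rewrite Es in le *.
have d : (w^-1%g j < w^-1%g i)%N.
  apply: perm_neq_lt; first exact: adj_neq.
  by apply/negP => lt; move: le; rewrite (length_mul_sref ji lt); lia.
split=> //; rewrite al eqxx /=.
by move: sz; rewrite (length_mul_sref_desc ji d) => -[->].
Qed.

(** The predicates allow descents to be chosen inside a parabolic subgroup: later [P] is membership
    in [S_k x S_(n-k)] and [Q] forbids the letter [k]. *)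
Lemma reduced_exists_in (P : pred 'S_n) (Q : pred nat) w :
  (forall w, P w -> w != 1%g -> exists i j,
      [/\ j = i.+1 :> nat, (w^-1%g j < w^-1%g i)%N, Q j & P (w * sref n j)%g]) ->
  P w -> exists2 s, reduced_word s w & all Q s.
Proof.
move=> H; have [m] := ubnP (perm_length w); elim: m w => // m IH w lm Pw.
have [->|w1] := eqVneq w 1%g; first by exists [::]; rewrite // /reduced_word /= length1 !eqxx.
have [i [j [ji d Qj Pj]]] := H w Pw w1.
have := lm; rewrite (length_mul_sref_desc ji d) ltnS => /IH /(_ Pj) [s rs Qs].
by exists (nat_of_ord j :: s); [exact: reduced_cons d rs | rewrite /= Qj].
Qed.

Lemma reduced_exists w : exists s, reduced_word s w.
Proof.
suff [s rs _] : exists2 s, reduced_word s w & all predT s by exists s.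
apply: (@reduced_exists_in predT predT) => // w' _ w1.
have [|i [j [ji d]]] := @exists_desc w'^-1%g; last by exists i, j.
by apply: contra w1 => /eqP E; rewrite -(invgK w') E invg1.
Qed.

Lemma reduced_rcons w i j s : j = i.+1 :> nat -> (w i < w j)%N ->
  reduced_word s w -> reduced_word (rcons s j) (sref n j * w)%g.
Proof.
move=> ji d; rewrite /reduced_word => /andP [/andP [al /eqP Ew] /eqP sz].
rewrite -cats1 all_cat al word_perm_cat /= mul1g Ew eqxx ltn_ord ji /= -ji.
by rewrite size_cat addn1 sz (length_sref_mul ji d).
Qed.

Lemma sref_far w i j i' j' : j = i.+1 :> nat -> j' = i'.+1 :> nat -> (j < i')%N ->
  [/\ (w * sref n j)^-1%g i' = w^-1%g i', (w * sref n j)^-1%g j' = w^-1%g j',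
      (w * sref n j')^-1%g i = w^-1%g i & (w * sref n j')^-1%g j = w^-1%g j].
Proof.
move=> ji ji' lt; rewrite !invMg !srefV (srefE ji) (srefE ji') !permM.
by rewrite !tpermD // -val_eqE /=; lia.
Qed.

Lemma sref_comm i j i' j' : j = i.+1 :> nat -> j' = i'.+1 :> nat -> (j < i')%N ->
  (sref n j * sref n j' = sref n j' * sref n j)%g.
Proof.
move=> ji ji' lt; rewrite (srefE ji) (srefE ji').
have : (tperm i' j' ^ tperm i j)%g = tperm i' j'.
  by rewrite tpermJ !tpermD // -val_eqE /=; lia.
by rewrite conjgE => E; rewrite -{1}E mulKVg.
Qed.

Lemma sref_braid i j (l : 'I_n) : j = i.+1 :> nat -> l = j.+1 :> nat ->
  (sref n j * sref n l * sref n j = sref n l * sref n j * sref n l)%g.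
Proof.
move=> ji lj; rewrite (srefE ji) (srefE lj).
have : (tperm j l ^ tperm i j)%g = (tperm i j ^ tperm j l)%g.
  by rewrite !tpermJ tpermL tpermR !tpermD // -val_eqE /=; lia.
by rewrite !conjgE !tpermV !mulgA.
Qed.

End Permutations.

(** * Independence of the reduced word *)

Section Matsumoto.
Variables (F : fieldType) (V : lmodType F) (n : nat) (T : nat -> V -> V).
Hypothesis braidT : forall i, (0 < i)%N -> (i.+1 < n)%N -> forall v,
  T i (T i.+1 (T i v)) = T i.+1 (T i (T i.+1 v)).
Hypothesis farT : forall i j, (0 < i < n)%N -> (0 < j < n)%N -> (i.+1 < j)%N -> forall v,
  T i (T j v) = T j (T i v).
Implicit Types (w : 'S_n) (s : seq nat).

Lemma T_word_cat s s' v : T_word T (s ++ s') v = T_word T s (T_word T s' v).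
Proof. by rewrite /T_word foldr_cat. Qed.

(** If the first letters differ, [w] descends along both, so it has reduced words that begin with
    the two sides of the commutation or braid relation and then agree. Induction on length compares
    each given word with the one sharing its first letter. *)
Theorem matsumoto s s' w : reduced_word s w -> reduced_word s' w ->
  forall v, T_word T s v = T_word T s' v.
Proof.
have [m] := ubnP (size s); elim: m s s' w => // m IH s s' w sm rs rs' v.
have sz : size s = size s'.
  by move/andP: rs => [_ /eqP ->]; move/andP: rs' => [_ /eqP ->].
case: s s' => [|a s] [|a' s'] // in sm rs rs' sz *.
have [i [j [aj ji d r]]] := reduced_consE rs.
have [i' [j' [aj' ji' d' r']]] := reduced_consE rs'; subst a a'.
move: sz => /= -[sz]; rewrite /= ltnS in sm.
wlog le : i j s i' j' s' sz rs rs' sm ji d r ji' d' r' / (j <= j')%N.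
  move=> W; have [le|/ltnW le] := leqP j j'; first exact: (W i j s i' j' s').
  by apply/esym; apply: (W i' j' s' i j s); rewrite -?sz.
have [/val_inj E|lt] := eqVneq (nat_of_ord j) j'.
  subst j'; congr T; apply: (IH _ _ (w * sref n j)%g) => //.
have jn := ltn_ord j; have jn' := ltn_ord j'.
have [far|near] := ltnP j i'.
  have [r0 rr] := reduced_exists (w * sref n j * sref n j')%g.
  have [E1 E2 E3 E4] := sref_far w ji ji' far.
  have ra : reduced_word (nat_of_ord j' :: r0) (w * sref n j)%g.
    by apply: (reduced_cons ji' _ rr); rewrite E1 E2.
  have rb : reduced_word (nat_of_ord j :: r0) (w * sref n j')%g.
    apply: (reduced_cons ji _ _); first by rewrite E3 E4.
    by rewrite -mulgA -(sref_comm ji ji' far) mulgA.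
  rewrite [LHS]/= [RHS]/= (IH _ _ _ sm r ra).
  rewrite (IH _ _ _ _ r' rb) -?sz //=.
  by apply: farT; lia.
have Ei : i' = j by apply: val_inj; move: lt near le => /eqP /=; lia.
subst i'.
(* The two descents make [w^-1] decreasing on [i < j < j'], so the longest element of this rank two
   subgroup splits off on the left. *)
have [r0 rr] := reduced_exists (w * sref n j * sref n j' * sref n j)%g.
have Vi : (w * sref n j')^-1%g i = w^-1%g i.
  by rewrite invMg srefV (srefE ji') permM tpermD // -val_eqE /=; lia.
have Vj' : (w * sref n j)^-1%g j' = w^-1%g j'.
  by rewrite invMg srefV (srefE ji) permM tpermD // -val_eqE /=; lia.
have Vi2 : (w * sref n j * sref n j')^-1%g i = w^-1%g j.
  rewrite invMg srefV (srefE ji') permM tpermD; [|by rewrite -val_eqE /=; lia..].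
  by rewrite (mul_srefE w ji).
have Vj'2 : (w * sref n j' * sref n j)^-1%g j' = w^-1%g j.
  rewrite invMg srefV (srefE ji) permM tpermD; [|by rewrite -val_eqE /=; lia..].
  by rewrite (mul_srefE w ji').
have ra : reduced_word [:: nat_of_ord j', nat_of_ord j & r0] (w * sref n j)%g.
  apply: (reduced_cons ji' _ _).
    by rewrite Vj' (mul_srefE w ji); apply: ltn_trans d.
  apply: (reduced_cons ji _ rr).
  by rewrite Vi2 (mul_srefE _ ji') Vj'.
have rb : reduced_word [:: nat_of_ord j, nat_of_ord j' & r0] (w * sref n j')%g.
  apply: (reduced_cons ji _ _).
    by rewrite Vi (mul_srefE w ji'); apply: ltn_trans d.
  apply: (reduced_cons ji' _ _).
    by rewrite Vj'2 (mul_srefE _ ji) Vi.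
  by rewrite -!mulgA (mulgA (sref n j')) -(sref_braid ji ji') !mulgA.
rewrite [LHS]/= [RHS]/= (IH _ _ _ sm r ra) (IH _ _ _ _ r' rb) -?sz //=.
by rewrite ji'; apply: braidT; lia.
Qed.

End Matsumoto.

(** * The eigenvector *)

Section Linearity.
Variables (F : fieldType) (V : lmodType F).
Implicit Types f g : V -> V.

Lemma linD f : lin f -> {morph f : u v / u + v}.
Proof. by move=> lf u v; have := lf 1 u v; rewrite !scale1r. Qed.

Lemma lin0 f : lin f -> f 0 = 0.
Proof. by move=> lf; apply: (addrI (f 0)); rewrite -linD // !addr0. Qed.

Lemma linZ f : lin f -> forall a, {morph f : u / a *: u}.
Proof. by move=> lf a u; have := lf a u 0; rewrite (lin0 lf) !addr0. Qed.

Lemma linN f : lin f -> {morph f : u / - u}.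
Proof. by move=> lf u; rewrite -scaleN1r linZ // scaleN1r. Qed.

Lemma linB f : lin f -> {morph f : u v / u - v}.
Proof. by move=> lf u v; rewrite linD // linN. Qed.

Lemma lin_id : lin (@id V).
Proof. by []. Qed.

Lemma lin_comp f g : lin f -> lin g -> lin (f \o g).
Proof. by move=> lf lg a u v /=; rewrite lg lf. Qed.

Lemma lin_add f g : lin f -> lin g -> lin (fun v => f v + g v).
Proof. by move=> lf lg a u v; rewrite lf lg scalerDr addrACA. Qed.

Lemma lin_scale c f : lin f -> lin (fun v => c *: f v).
Proof. by move=> lf a u v; rewrite lf scalerDr !scalerA mulrC. Qed.

Lemma lin_zero : lin (fun _ : V => 0 : V).
Proof. by move=> a u v; rewrite scaler0 addr0. Qed.

Lemma lin_sum (I : Type) (r : seq I) (P : pred I) (f : I -> V -> V) :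
  (forall i, P i -> lin (f i)) -> lin (fun v => \sum_(i <- r | P i) f i v).
Proof.
move=> lf a u v; rewrite scaler_sumr -big_split; apply: eq_bigr => i Pi.
exact: lf.
Qed.

Lemma lin_foldl (I : eqType) (f : I -> V -> V) (l : seq I) :
  {in l, forall i, lin (f i)} -> lin (fun v => foldl (fun u i => f i u) v l).
Proof.
elim: l => [|i l IH] lf a u v //=; rewrite (lf i) ?mem_head //.
by apply: IH => j jl; apply: lf; rewrite inE jl orbT.
Qed.

Lemma lin_T_word (T : nat -> V -> V) (P : pred nat) s :
  (forall i, P i -> lin (T i)) -> all P s -> lin (T_word T s).
Proof.
move=> lT; elim: s => [|a s IH] /=; first by move=> _; exact: lin_id.
by case/andP=> /lT Ta /IH; exact: lin_comp.
Qed.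

End Linearity.

Section Eigenvector.
Variables (F : fieldType) (V : lmodType F) (n : nat) (p q hbar : F) (t : nat -> F).
Variables (T x : nat -> V -> V) (Y : 'S_n -> V) (ev : V -> F).
Hypothesis rep : schubert_rep p q hbar t T x Y ev.
Implicit Types (w : 'S_n) (s : seq nat).

Let lT := T_lin rep.
Let lx := x_lin rep.

(** Composing [w] with the simple reflection on the right multiplies [w^-1 w0] by it on the left; a
    descent of [w] is an ascent there, so the word stays reduced. *)
Lemma TY_desc w (i j : 'I_n) : j = i.+1 :> nat -> (w j < w i)%N ->
  T j (Y w) = Y (sref n j * w)%g.
Proof.
move=> ji d; have [s rs] := reduced_exists (w0 n * w^-1)%g.
suff r : reduced_word (nat_of_ord j :: s) (w0 n * (sref n j * w)^-1)%g.
  by rewrite (Y_def rep rs) (Y_def rep r).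
apply: (reduced_cons ji); first rewrite !invMg !invgK w0V.
  have [-> ->] : (((sref n j * w) * w0 n)%g j = w0 n (w i)) *
      (((sref n j * w) * w0 n)%g i = w0 n (w j)).
    by rewrite !(permM _ (w0 n)); have [-> ->] := sref_mulE w ji.
  by rewrite !permE /=; have := ltn_ord (w i); lia.
by rewrite invMg srefV -!mulgA sref_invol mulg1.
Qed.

Lemma T_sq i v : (0 < i < n)%N -> T i (T i v) = (q - p) *: T i v + (p * q) *: v.
Proof.
move=> /(T_quad rep) /(_ v) /eqP; rewrite subr_eq0 => /eqP <-.
by rewrite -opprB scaleNr addrC addrK.
Qed.

Lemma TY_asc w (i j : 'I_n) : j = i.+1 :> nat -> (w i < w j)%N ->
  T j (Y w) = (q - p) *: Y w + (p * q) *: Y (sref n j * w)%g.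
Proof.
move=> ji a; set w' := (sref n j * w)%g.
have jn : (0 < j < n)%N by rewrite ltn_ord ji.
have -> : Y w = T j (Y w').
  rewrite (TY_desc ji); first by rewrite mulgA sref_invol mul1g.
  by have [-> ->] := sref_mulE w ji.
by rewrite T_sq.
Qed.

Lemma ev0 : ev 0 = 0.
Proof.
have := ev_lin rep 1 0 0; rewrite scaler0 addr0 mul1r => E.
by apply: (addrI (ev 0)); rewrite addr0 -E.
Qed.

Lemma evD : {morph ev : u v / u + v}.
Proof. by move=> u v; have := ev_lin rep 1 u v; rewrite scale1r mul1r. Qed.

Lemma evZ a v : ev (a *: v) = a * ev v.
Proof. by rewrite -[a *: v]addr0 (ev_lin rep) ev0 addr0. Qed.

Lemma evB : {morph ev : u v / u - v}.
Proof. by move=> u v; rewrite evD -scaleN1r evZ mulN1r. Qed.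

Lemma ev_sum (I : Type) (r : seq I) (P : pred I) (f : I -> V) :
  ev (\sum_(i <- r | P i) f i) = \sum_(i <- r | P i) ev (f i).
Proof. exact: (big_morph ev evD ev0). Qed.

Lemma ev_xv i v : (0 < i <= n)%N -> ev (x i v) = t i * ev v.
Proof.
move=> i_n; have [c ->] := Y_span rep v; rewrite ev_sum mulr_sumr.
have -> : x i (\sum_w c w *: Y w) = \sum_w c w *: x i (Y w).
  rewrite (big_morph (x i) (linD (lx i_n)) (lin0 (lx i_n))).
  by apply: eq_bigr => w _; rewrite linZ //; apply: lx.
by rewrite ev_sum; apply: eq_bigr => w _; rewrite !evZ (ev_x rep) // mulrCA.
Qed.

Let letters s := all (fun a => (0 < a < n)%N) s.

(** Each letter shortens [w] by at most one. Under the length bound [Y 1] is reached only if every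
    letter is a descent, and then [w] is the product of the word. *)
Lemma ev_TY_0 s w : letters s -> (size s <= perm_length w)%N -> w <> word_perm n s ->
  ev (T_word T s (Y w)) = 0.
Proof.
elim/last_ind: s w => [|s a IH] w.
  move=> _ _ w1; apply/eqP; apply: contra_notT w1 => /eqP nz.
  exact/(ev_Y rep).
rewrite /letters all_rcons size_rcons => /andP [an ls] sz.
have [i [j [aj ji]]] := letterP an; subst a.
rewrite -cats1 word_perm_cat T_word_cat /= mul1g => wE.
have lin_s : lin (T_word T s) by apply: lin_T_word ls.
have big w' : (size s < perm_length w')%N -> ev (T_word T s (Y w')) = 0.
  move=> lt; apply: IH => //; first exact: ltnW.
  by move=> E; have := length_word_le ls; rewrite -E; lia.
have [a|/(perm_neq_lt (adj_neq ji)) d] := boolP (w i < w j)%N.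
  rewrite (TY_asc ji a) (linD lin_s) !(linZ lin_s) evD !evZ !big ?mulr0 ?addr0 //.
  by rewrite (length_sref_mul ji a); lia.
rewrite (TY_desc ji d) IH //.
  by have := length_sref_mul_desc ji d; lia.
by move=> E; apply: wE; rewrite -E mulgA sref_invol mul1g.
Qed.

Lemma TY_reduced s w : reduced_word s w -> T_word T s (Y w) = Y 1%g.
Proof.
elim/last_ind: s w => [|s a IH] w.
  by case/andP=> /andP [_ /eqP <-].
rewrite /reduced_word all_rcons size_rcons -cats1 word_perm_cat T_word_cat /= mul1g.
case/andP=> /andP [/andP [an ls] /eqP <-] /eqP sz.
have [i [j [aj ji]]] := letterP an; subst a.
have le := length_word_le ls.
have [d|/(perm_neq_lt (adj_neq ji)) a] := boolP (word_perm n s i < word_perm n s j)%N; last first.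
  by have := length_sref_mul_desc ji a; lia.
rewrite (TY_desc ji); last by have [-> ->] := sref_mulE (word_perm n s) ji.
rewrite mulgA sref_invol mul1g; apply: IH.
rewrite /reduced_word ls eqxx /=.
by move: sz; rewrite (length_sref_mul ji d) => -[->].
Qed.

(** In the basis [Y] ordered by length, the functionals [ev o T_w] form a triangular matrix with
    diagonal entry [ev (Y 1)], which is nonzero. *)
Lemma ev_separates v :
  (forall s, letters s -> (size s <= perm_length (w0 n))%N -> ev (T_word T s v) = 0) ->
  v = 0.
Proof.
move=> H; have [c Ev] := Y_span rep v.
suff c0 w : c w = 0 by rewrite Ev big1 // => w _; rewrite c0 scale0r.
have [m] := ubnP (perm_length w); elim: m w => // m IH w; rewrite ltnS => lm.
have [s rs] := reduced_exists w.
have /andP [/andP [ls /eqP Ew] /eqP sz] := rs.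
have lin_s : lin (T_word T s) by apply: lin_T_word ls.
have := H s ls; rewrite sz length_le_w0 => /(_ isT).
rewrite Ev (big_morph (T_word T s) (linD lin_s) (lin0 lin_s)) ev_sum (bigD1 w) //=.
rewrite big1 => [|w' ww'].
  rewrite addr0 (linZ lin_s) evZ TY_reduced // => /eqP; rewrite mulf_eq0 => /orP [/eqP //|/eqP E].
  by have /(ev_Y rep) := erefl (1%g : 'S_n); rewrite E.
have [lt|ge] := ltnP (perm_length w') (perm_length w).
  by rewrite IH ?scale0r ?(lin0 lin_s) ?ev0 //; lia.
by rewrite (linZ lin_s) evZ ev_TY_0 ?mulr0 ?sz // Ew => E; rewrite E eqxx in ww'.
Qed.

(* The error terms of moving [x_i] to the left of [T_s]: they involve shorter words only,
   so [ev] annihilates them at [v = Y (w0 n)]. *)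
Inductive lower (m : nat) (v : V) : V -> Prop :=
| lower0 : lower m v 0
| lowerD u u' : lower m v u -> lower m v u' -> lower m v (u + u')
| lowerZ a u : lower m v u -> lower m v (a *: u)
| lowerT s : letters s -> (size s < m)%N -> lower m v (T_word T s v)
| lowerxT s i : letters s -> (size s < m)%N -> (0 < i <= n)%N ->
    lower m v (x i (T_word T s v)).

Lemma lowerN m v u : lower m v u -> lower m v (- u).
Proof. by rewrite -scaleN1r; apply: lowerZ. Qed.

(** The three relations between [T] and [x] brought to one shape, with [c] equal to 1, -1 or 0; only
    the shape of the error is used afterwards. *)
Lemma T_x_cases (j i : 'I_n) v : (0 < j)%N -> exists c : F,
  T j (x i.+1 v) = x (sref n j i).+1 (T j v) + c *: (hbar *: v - (p - q) *: x j v).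
Proof.
move=> j0; have jn : (0 < j < n)%N by rewrite j0 ltn_ord.
have [l [j' [/val_inj Ej jl]]] := letterP jn; subst j'.
rewrite (srefE jl); case: tpermP => [->|->|il ij].
- by exists 1; rewrite scale1r -jl (Tx_i rep).
- by exists (-1); rewrite scaleN1r -jl (Tx_i1 rep).
exists 0; rewrite scale0r addr0 (Tx_comm rep) //; first by rewrite ltn_ord.
  by move=> E; apply: il; apply: val_inj => /=; lia.
by move=> E; apply: ij; apply: val_inj => /=; lia.
Qed.

Lemma lower_mono m m' v u : (m <= m')%N -> lower m v u -> lower m' v u.
Proof.
move=> le; elim=> [|? ? _ ? _ ?|? ? _ ?|s ls sz|s i ls sz i_n].
- exact: lower0.
- exact: lowerD.
- exact: lowerZ.
- by apply: lowerT => //; lia.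
by apply: lowerxT => //; lia.
Qed.

Lemma lower_T m v u (j : 'I_n) : (0 < j)%N -> lower m v u -> lower m.+1 v (T j u).
Proof.
move=> j0; have jn : (0 < j < n)%N by rewrite j0 ltn_ord.
have jn' : (0 < j <= n)%N by lia.
elim=> [|u1 u2 _ IH1 _ IH2|a u1 _ IH|s ls sz|s i ls sz i_n].
- by rewrite (lin0 (lT jn)); exact: lower0.
- by rewrite (linD (lT jn)); exact: lowerD.
- by rewrite (linZ (lT jn)); exact: lowerZ.
- by apply: (@lowerT m.+1 v (nat_of_ord j :: s)) => //=; rewrite jn.
case: i i_n => // i i_n; have [c] := @T_x_cases j (Ordinal i_n) (T_word T s v) j0.
move=> /= ->; apply: lowerD.
  apply: (@lowerxT m.+1 v (nat_of_ord j :: s)) => //=; first by rewrite jn.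
apply/lowerZ/lowerD; first by apply/lowerZ/lowerT => //; lia.
by apply/lowerN/lowerZ/lowerxT => //; lia.
Qed.

Lemma T_word_x s (i : 'I_n) v : letters s ->
  lower (size s) v (T_word T s (x i.+1 v) - x (word_perm n s i).+1 (T_word T s v)).
Proof.
elim: s => [|a s IH] /=; first by rewrite perm1 subrr => _; exact: lower0.
case/andP=> an ls; have [i' [j [aj ji]]] := letterP an; subst a.
have j0 : (0 < j)%N by rewrite ji.
have jn' : (0 < j <= n)%N by have := ltn_ord j; lia.
have /(lower_T j0) := IH ls; rewrite (linB (lT an)).
have [c ->] := T_x_cases (word_perm n s i) (T_word T s v) j0.
set A := hbar *: _ - _; rewrite permM opprD addrA => L.
rewrite -[X in lower _ _ X](subrK (c *: A)).
apply: lowerD; first exact: L.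
apply/lowerZ/lowerD; first by apply/lowerZ/lowerT.
by apply/lowerN/lowerZ/lowerxT.
Qed.

Lemma ev_lower u : lower (perm_length (w0 n)) (Y (w0 n)) u -> ev u = 0.
Proof.
have ev_T s : letters s -> (size s < perm_length (w0 n))%N ->
    ev (T_word T s (Y (w0 n))) = 0.
  move=> ls sz; apply: ev_TY_0 => //; first exact: ltnW.
  by move=> E; have := length_word_le ls; rewrite -E; lia.
elim=> [|u1 u2 _ E1 _ E2|a u1 _ E|s ls sz|s i ls sz i_n].
- exact: ev0.
- by rewrite evD E1 E2 addr0.
- by rewrite evZ E mulr0.
- exact: ev_T.
by rewrite ev_xv // ev_T // mulr0.
Qed.

Lemma x_Y_w0 (i : 'I_n) : x i.+1 (Y (w0 n)) = t (n - i)%N *: Y (w0 n).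
Proof.
apply/eqP; rewrite -subr_eq0; apply/eqP; apply: ev_separates => s ls sz.
have lin_s : lin (T_word T s) by apply: lin_T_word ls.
rewrite (linB lin_s) (linZ lin_s) -(subrK (x (word_perm n s i).+1 (T_word T s (Y (w0 n))))
   (T_word T s _)) -addrA evD ev_lower; last exact: lower_mono (T_word_x _ _ ls).
rewrite add0r evB evZ ev_xv; last by rewrite ltn_ord.
(* After the error terms are killed, the word contributes [t] at the image of [i]. Either that image
   is given by [w0], hence the reversed index [n - i], or [ev] vanishes on the word. *)
have [->|/eqP E] := eqVneq (word_perm n s) (w0 n).
  rewrite permE /= -subSn ?subSS ?subrr //; exact: ltn_ord.
rewrite ev_TY_0 ?mulr0 ?subrr //.
by move=> E'; apply: E; rewrite E'.
Qed.

End Eigenvector.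

(** * The transfer matrix *)

Section Transfer.
Variables (F : fieldType) (V : lmodType F) (p q hbar z : F).

(** The sum [[m]] of all [p^a q^b] with [a + b = m - 1]: the weight with which one of [m] pending
    jumps starts at a given particle, the jumps made before it crossing a particle there and those
    made after it a hole. *)
Fixpoint pq_num (m : nat) : F := if m is m'.+1 then p * pq_num m' + q ^+ m' else 0.

(** At a site still occupied in the end, [p^m (1 + z tau)] accounts for [m] jumps passing the
    particle, without or with the diagonal term of [R_i], and [z (hbar - (p - q) tau) [m]] for one
    of them taking it and a later jump landing on the freed site. As [(p - q) [m] = p^m - q^m], the
    sum is the coefficient used here, with [X] in place of [tau]. *)
Definition stay (X : V -> V) m v := (p ^+ m + z * hbar * pq_num m) *: v + (z * q ^+ m) *: X v.
Definition xi (X : V -> V) v := hbar *: v - (p - q) *: X v.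

(* [m] jumps are pending; site [s] carries the operator [X s]. *)
Fixpoint transfer (X : nat -> V -> V) (m s : nat) (b : seq bool)
    (f : seq bool -> V -> V) (v : V) {struct b} : V :=
  match b with
  | [::] => if m == 0%N then f [::] v else 0
  | false :: c =>
      q ^+ m *: transfer X m s.+1 c (f \o cons false) v
      + (z * q ^+ m) *: transfer X m.+1 s.+1 c (f \o cons true) (xi (X s) v)
  | true :: c =>
      transfer X m s.+1 c (f \o cons true) (stay (X s) m v)
      + pq_num m *: transfer X m.-1 s.+1 c (f \o cons false) v
  end.

Lemma lin_stay X m : lin X -> lin (stay X m).
Proof. by move=> lX; apply: lin_add; apply: lin_scale; [exact: lin_id|]. Qed.

Lemma lin_xi X : lin X -> lin (xi X).
Proof.
move=> lX a u v.
have := lin_add (lin_scale hbar (@lin_id _ V)) (lin_scale (- (p - q)) lX) a u v.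
by rewrite !scaleNr.
Qed.

Section Fixed.
Variables (X : nat -> V -> V) (N : nat).
Hypothesis linX : forall s, (s < N)%N -> lin (X s).

Lemma transfer_ext m s b f g v :
  (forall c u, size c = size b -> f c u = g c u) ->
  transfer X m s b f v = transfer X m s b g v.
Proof.
elim: b m s f g v => [|[] b IH] m s f g v fg /=; first by rewrite fg.
  by congr (_ + _ *: _); apply: IH => c u sz /=; apply: fg; rewrite /= sz.
by congr (_ *: _ + _ *: _); apply: IH => c u sz /=; apply: fg; rewrite /= sz.
Qed.

Lemma lin_transfer m s b f : (s + size b <= N)%N -> (forall c, lin (f c)) ->
  lin (transfer X m s b f).
Proof.
elim: b m s f => [|[] b IH] m s f /= sz lf.
- by case: eqP => _; [exact: lf | exact: lin_zero].
- apply: lin_add.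
    apply: lin_comp; last by apply/lin_stay/linX; lia.
    by apply: IH => [|c]; [lia | exact: lf].
  by apply/lin_scale/IH => [|c]; [lia | exact: lf].
apply: lin_add; first by apply/lin_scale/IH => [|c]; [lia | exact: lf].
apply/lin_scale/lin_comp; last by apply/lin_xi/linX; lia.
by apply: IH => [|c]; [lia | exact: lf].
Qed.

(** Used beyond the exchanged pair of sites, with [S] the operator [T] or a scalar. *)
Lemma transfer_shift m s b f (S : V -> V) v : lin S ->
  (forall s', (s <= s' < s + size b)%N -> forall u, X s' (S u) = S (X s' u)) ->
  transfer X m s b f (S v) = transfer X m s b (fun c u => f c (S u)) v.
Proof.
move=> lS; elim: b m s f v => [|[] b IH] m s f v /= H.
- by case: eqP.
- have -> : stay (X s) m (S v) = S (stay (X s) m v).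
    by rewrite /stay H ?(linD lS) ?(linZ lS) //; lia.
  by rewrite !IH // => s' s'b; apply: H; lia.
have -> : xi (X s) (S v) = S (xi (X s) v).
  by rewrite /xi H ?(linB lS) ?(linZ lS) //; lia.
by rewrite !IH // => s' s'b; apply: H; lia.
Qed.

End Fixed.

(** * The exchange relation on two sites *)

Section Exchange.
Variables (T X0 X1 : V -> V).
Hypotheses (lT : lin T) (lX0 : lin X0) (lX1 : lin X1).
Hypothesis T_sq : forall v, T (T v) = (q - p) *: T v + (p * q) *: v.
Hypothesis TX0 : forall v, T (X0 v) = X1 (T v) + xi X0 v.
Hypothesis TX1 : forall v, T (X1 v) = X0 (T v) - xi X0 v.
Hypothesis X01 : forall v, X0 (X1 v) = X1 (X0 v).

Lemma xi1_T v : xi X1 (T v) = T (xi X0 v) + (p - q) *: xi X0 v.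
Proof.
have -> : T (xi X0 v) = hbar *: T v - (p - q) *: T (X0 v).
  by rewrite /xi (linB lT) !(linZ lT).
by rewrite TX0 scalerDr opprD addrA subrK.
Qed.

Lemma X0_T v : X0 (T v) = T (X1 v) + xi X0 v.
Proof. by rewrite TX1 subrK. Qed.

Lemma xi1_X0_T v : xi X1 (X0 (T v)) = T (X1 (xi X0 v)) + hbar *: xi X0 v.
Proof.
have X1xi u : xi X0 (X1 u) = X1 (xi X0 u).
  by rewrite /xi X01 (linB lX1) !(linZ lX1).
rewrite X0_T (linD (lin_xi lX1)) xi1_T X1xi -addrA; congr (_ + _).
by rewrite {2}/xi addrC -addrA addNr addr0.
Qed.

Variables (f00 f01 f10 f11 : V -> V) (m : nat).
Hypotheses (l00 : lin f00) (l01 : lin f01) (l10 : lin f10) (l11 : lin f11).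
Hypothesis f00T : forall v, f00 (T v) = q *: f00 v.
Hypothesis f11T : forall v, f11 (T v) = q *: f11 v.
Hypothesis f10T : forall v, f10 (T v) = f01 v.

(** The two sides scan [10] fed with [T v] and [01] fed with [v]; [f_ab] is the rest of the scan
    after output bits [a], [b], with its own number of pending jumps. Outputs [00] and [11] match
    separately, while [10] and [01] have to be treated together because [f01 o T] involves both. *)
Lemma exchange v :
  q ^+ m *: f10 (stay X0 m (T v)) + (z * q ^+ m) *: f11 (xi X1 (stay X0 m (T v)))
  + pq_num m *: (q ^+ m.-1 *: f00 (T v) + (z * q ^+ m.-1) *: f01 (xi X1 (T v))) =
  q ^+ m *: (f01 (stay X1 m v) + pq_num m *: f00 v)
  + (z * q ^+ m) *: (f11 (stay X1 m.+1 (xi X0 v)) + pq_num m.+1 *: f10 (xi X0 v)).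
Proof.
have f01T u : f01 (T u) = (q - p) *: f01 u + (p * q) *: f10 u.
  by rewrite -f10T T_sq (linD l10) !(linZ l10) f10T.
have qm : pq_num m * q ^+ m.-1 * q = q ^+ m * pq_num m.
  by case: m => [|m'] /=; rewrite ?mul0r ?mulr0 // exprS; ring.
have E00 : pq_num m *: (q ^+ m.-1 *: f00 (T v)) = q ^+ m *: (pq_num m *: f00 v).
  by rewrite f00T !scalerA qm.
have E11 : f11 (xi X1 (stay X0 m (T v))) = f11 (stay X1 m.+1 (xi X0 v)).
  rewrite /stay (linD (lin_xi lX1)) !(linZ (lin_xi lX1)) xi1_X0_T xi1_T.
  move: (xi X0 v) => w.
  rewrite !(linD l11) !(linZ l11) !(linD l11) !(linZ l11) !f11T.
  move: (f11 w) (f11 (X1 w)) => a b.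
  have -> : q *: a + (p - q) *: a = p *: a by rewrite -scalerDl addrC subrK.
  rewrite scalerDr !scalerA addrCA addrC; congr (_ + _ *: b); last by rewrite exprS; ring.
  by rewrite -scalerDl; congr (_ *: a); rewrite /= exprS; ring.
have E10 : q ^+ m *: f10 (stay X0 m (T v)) + pq_num m *: ((z * q ^+ m.-1) *: f01 (xi X1 (T v)))
    = q ^+ m *: f01 (stay X1 m v) + (z * q ^+ m) *: (pq_num m.+1 *: f10 (xi X0 v)).
  rewrite /stay X0_T xi1_T; move: (xi X0 v) => w.
  rewrite !(linD l10) !(linD l01) !(linZ l10) !(linZ l01) (linD l10).
  rewrite !f10T f01T; move: (f10 w) (f01 w) => a b.
  have -> : (q - p) *: b + (p * q) *: a + (p - q) *: b = (p * q) *: a.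
    by rewrite addrAC -scalerDl addrA subrK subrr scale0r add0r.
  rewrite !scalerDr !scalerA -!addrA; congr (_ + (_ + _)).
  rewrite -scalerDl; congr (_ *: a).
  have -> : pq_num m * (z * q ^+ m.-1) * (p * q) = z * p * (pq_num m * q ^+ m.-1 * q) by ring.
  by rewrite qm /=; ring.
rewrite E11 !scalerDr.
rewrite E00 [X in _ + X = _]addrC addrACA E10.
by rewrite [X in _ = _ + X]addrC [RHS]addrACA [X in _ + X = _]addrC.
Qed.

End Exchange.

(** * The exchange relation inside a longer string *)

Section Step.
Variables (X : nat -> V -> V) (N i : nat) (T : V -> V).
Hypothesis linX : forall s, (s < N)%N -> lin (X s).
Hypothesis lT : lin T.
Hypothesis iN : (i.+1 < N)%N.
Hypothesis T_sq : forall v, T (T v) = (q - p) *: T v + (p * q) *: v.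
Hypothesis TX0 : forall v, T (X i v) = X i.+1 (T v) + xi (X i) v.
Hypothesis TX1 : forall v, T (X i.+1 v) = X i (T v) - xi (X i) v.
Hypothesis XX : forall v, X i (X i.+1 v) = X i.+1 (X i v).
Hypothesis TX : forall s, (s < N)%N -> s != i -> s != i.+1 -> forall v, X s (T v) = T (X s v).

(** [T] commutes with the sites of the prefix and of the suffix. Past the pair it is carried to the
    final operators [f], whose two hypotheses become those on [f_ab] in [exchange]. *)
Lemma transfer_exchange m s pre post f v :
  (s + size pre = i)%N -> (i.+2 + size post <= N)%N ->
  (forall c, lin (f c)) ->
  (forall c d u, size c = size pre -> size d = size post ->
     f (c ++ [:: true, false & d]) (T u) = f (c ++ [:: false, true & d]) u) ->
  (forall a c d u, size c = size pre -> size d = size post ->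
     f (c ++ [:: a, a & d]) (T u) = q *: f (c ++ [:: a, a & d]) u) ->
  transfer X m s (pre ++ [:: true, false & post]) f (T v) =
  transfer X m s (pre ++ [:: false, true & post]) f v.
Proof.
elim: pre m s f v => [|a pre IH] m s f v /= si sN lf f10 faa.
  rewrite addn0 in si; subst s.
  have lg a b m' : lin (transfer X m' i.+2 post (f \o cons a \o cons b)).
    by apply: (lin_transfer linX) => // c; apply: lf.
  have sh m' g u : transfer X m' i.+2 post g (T u) =
      transfer X m' i.+2 post (fun c u => g c (T u)) u.
    by apply: transfer_shift => // s' s'i u'; apply: TX; lia.
  have faa' a m' u : transfer X m' i.+2 post (f \o cons a \o cons a) (T u) =
      q *: transfer X m' i.+2 post (f \o cons a \o cons a) u.
    rewrite sh -(linZ (lg a a m')) (@transfer_shift _ _ _ _ _ (fun u => q *: u)).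
    - by apply: transfer_ext => c u' sz /=; rewrite (faa a [::]) // (linZ (lf _)).
    - by apply: lin_scale; exact: lin_id.
    by move=> s' s'i u'; rewrite (linZ (linX _)) //; lia.
  pose g a b m' := transfer X m' i.+2 post (f \o cons a \o cons b).
  (* The scan yields [m.-1.+1] where [exchange] expects [m]; they differ only at [m = 0], where
     [pq_num] vanishes. *)
  have pred_succ a u : pq_num m *: (a + (z * q ^+ m.-1) *: g false true m.-1.+1 u) =
      pq_num m *: (a + (z * q ^+ m.-1) *: g false true m u).
    by case: (m) => [|//]; rewrite !scale0r.
  rewrite pred_succ.
  apply: (@exchange T (X i) (X i.+1) lT _ T_sq TX0 TX1 XX (g false false m.-1)
     (g false true m) (g true false m) (g true true m.+1)) => //; try by [apply: linX; lia | exact: lg | exact: faa'].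
  by move=> u; rewrite /g sh; apply: transfer_ext => c u' sz /=; apply: (f10 [::]).
have XT u : X s (T u) = T (X s u) by apply: TX; lia.
have IH' m' b u := IH m' s.+1 (f \o cons b) u.
case: a => /=.
  have -> : stay (X s) m (T v) = T (stay (X s) m v).
    by rewrite /stay XT (linD lT) !(linZ lT).
  congr (_ + _ *: _); apply: IH' => //; try lia.
  - by move=> c; apply: lf.
  - by move=> c d u sc sd /=; rewrite -!cat_cons; apply: f10; rewrite //= sc.
  - by move=> a c d u sc sd /=; rewrite -!cat_cons; apply: faa; rewrite //= sc.
  - by move=> c; apply: lf.
  - by move=> c d u sc sd /=; rewrite -!cat_cons; apply: f10; rewrite //= sc.
  - by move=> a c d u sc sd /=; rewrite -!cat_cons; apply: faa; rewrite //= sc.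
have -> : xi (X s) (T v) = T (xi (X s) v).
  by rewrite /xi XT (linB lT) !(linZ lT).
congr (_ *: _ + _ *: _); apply: IH' => //; try lia.
- by move=> c; apply: lf.
- by move=> c d u sc sd /=; rewrite -!cat_cons; apply: f10; rewrite //= sc.
- by move=> a c d u sc sd /=; rewrite -!cat_cons; apply: faa; rewrite //= sc.
- by move=> c; apply: lf.
- by move=> c d u sc sd /=; rewrite -!cat_cons; apply: f10; rewrite //= sc.
- by move=> a c d u sc sd /=; rewrite -!cat_cons; apply: faa; rewrite //= sc.
Qed.

End Step.

(** No particle is left to be a source, so neither an old nor a new jump could be completed. *)
Lemma transfer_zeros X m s g f v :
  transfer X m s (nseq g false) f v = if m == 0%N then f (nseq g false) v else 0.
Proof.
elim: g m s f v => [|g IH] m s f v //=; rewrite !IH /= scaler0 addr0.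
by case: eqP => [->|_]; rewrite ?scale1r ?scaler0.
Qed.

Lemma transfer_ones X s k b f v :
  transfer X 0 s (nseq k true ++ b) f v =
  transfer X 0 (s + k) b (fun c => f (nseq k true ++ c))
    (foldl (fun u i => u + z *: X i u) v (iota s k)).
Proof.
elim: k s f v => [|k IH] s f v /=; first by rewrite addn0.
rewrite scale0r addr0 IH addSnnS; congr (transfer _ _ _ _ _ (foldl _ _ _)).
by rewrite /stay /= !mulr0 addr0 scale1r mulr1.
Qed.

Lemma transfer_top X k g f v :
  transfer X 0 0 (nseq k true ++ nseq g false) f v =
  f (nseq k true ++ nseq g false) (foldl (fun u i => u + z *: X i u) v (iota 0 k)).
Proof. by rewrite transfer_ones transfer_zeros. Qed.

(** The scan on a common eigenvector, where the site operators become the scalars [tau s]; this is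
    the form that the [R_i] produce. *)
Fixpoint transfer_sc (tau : nat -> F) (m s : nat) (b : seq bool) (y : seq bool -> V) : V :=
  match b with
  | [::] => if m == 0%N then y [::] else 0
  | false :: c =>
      q ^+ m *: transfer_sc tau m s.+1 c (y \o cons false)
      + (z * q ^+ m * (hbar - (p - q) * tau s)) *:
          transfer_sc tau m.+1 s.+1 c (y \o cons true)
  | true :: c =>
      (p ^+ m + z * hbar * pq_num m + z * q ^+ m * tau s) *:
          transfer_sc tau m s.+1 c (y \o cons true)
      + pq_num m *: transfer_sc tau m.-1 s.+1 c (y \o cons false)
  end.

Lemma transfer_eigen X N tau m s b f v :
  (forall s, (s < N)%N -> lin (X s)) ->
  (forall s, (s < N)%N -> X s v = tau s *: v) -> (forall c, lin (f c)) ->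
  (s + size b <= N)%N ->
  transfer X m s b f v = transfer_sc tau m s b (fun c => f c v).
Proof.
move=> linX ev; elim: b m s f => [|[] b IH] m s f lf //= sN.
  have -> : stay (X s) m v = (p ^+ m + z * hbar * pq_num m + z * q ^+ m * tau s) *: v.
    by rewrite /stay ev ?scalerA -?scalerDl //; lia.
  rewrite (linZ (@lin_transfer X N linX m s.+1 b _ _ _)); [|lia|by move=> c; apply: lf].
  by rewrite !IH //; try lia; move=> c; apply: lf.
have -> : xi (X s) v = (hbar - (p - q) * tau s) *: v.
  by rewrite /xi ev ?scalerA -?scalerBl //; lia.
rewrite (linZ (@lin_transfer X N linX m.+1 s.+1 b _ _ _)); [|lia|by move=> c; apply: lf].
by rewrite scalerA !IH //; try lia; move=> c; apply: lf.
Qed.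

End Transfer.

(** * Jumps *)

Section Jumps.
Variables (F : fieldType) (V : lmodType F) (p q hbar z : F) (tau : nat -> F).
Implicit Types (b c : seq bool) (y : seq bool -> V).

Local Notation tsc := (transfer_sc p q hbar z tau).
Local Notation pqn := (pq_num p q).

(** The departure of a jump that lands just before [b]: a factor [p] for each particle and [q] for
    each hole crossed on the way from the source. *)
Fixpoint remove_one b y : V :=
  match b with
  | [::] => 0
  | false :: c => q *: remove_one c (y \o cons false)
  | true :: c => y (false :: c) + p *: remove_one c (y \o cons true)
  end.

(** [R_i] on the part of the string after particle [i - 1]: its leading holes are the landing sites
    and its first particle gives the diagonal term. *)
Fixpoint jump s b y : V :=
  match b with
  | [::] => 0
  | false :: c => jump s.+1 c (y \o cons false)
                  + (hbar - (p - q) * tau s) *: remove_one c (y \o cons true)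
  | true :: c => tau s *: y b
  end.

Lemma remove_one_ext b y y' :
  (forall c, size c = size b -> (ones c).+1 = ones b -> y c = y' c) ->
  remove_one b y = remove_one b y'.
Proof.
elim: b y y' => [|[] b IH] y y' E //=.
  by rewrite E //; congr (_ + _ *: _); apply: IH => c sz o; apply: E; rewrite /= ?sz // -o.
by congr (_ *: _); apply: IH => c sz o; apply: E; rewrite /= ?sz.
Qed.

Lemma remove_one_comb b y y' a a' :
  remove_one b (fun c => a *: y c + a' *: y' c) = a *: remove_one b y + a' *: remove_one b y'.
Proof.
elim: b y y' => [|[] b IH] y y' /=; first by rewrite !scaler0 addr0.
  by rewrite [remove_one b _](IH (y \o cons true) (y' \o cons true)) !scalerDr !scalerA
    addrACA [p * a]mulrC [p * a']mulrC.
by rewrite [remove_one b _](IH (y \o cons false) (y' \o cons false)) !scalerDr !scalerA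
  [q * a]mulrC [q * a']mulrC.
Qed.

Lemma remove_one_lin f b y : lin f -> f (remove_one b y) = remove_one b (f \o y).
Proof.
move=> lf; elim: b y => [|[] b IH] y /=; first exact: lin0.
  by rewrite (linD lf) (linZ lf) IH.
by rewrite (linZ lf) IH.
Qed.

Lemma jump_lin f s b y : lin f -> f (jump s b y) = jump s b (f \o y).
Proof.
move=> lf; elim: b s y => [|[] b IH] s y /=; first exact: lin0.
  by rewrite (linZ lf).
by rewrite (linD lf) (linZ lf) IH (remove_one_lin _ _ lf).
Qed.

(* Of the [m + 1] pending jumps, the one with the furthest landing site is made first. *)
Lemma transfer_succ m s b y : tsc m.+1 s b y = remove_one b (fun c => tsc m s c y).
Proof.
elim: b m s y => [|[] b IH] m s y //=.
  rewrite [remove_one b _](remove_one_comb b (fun c => tsc m s.+1 c (y \o cons true))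
     (fun c => tsc m.-1 s.+1 c (y \o cons false))).
  rewrite -!IH scalerDr !scalerA.
  have -> : (p * pqn m) *: tsc m.-1.+1 s.+1 b (y \o cons false) =
      (p * pqn m) *: tsc m s.+1 b (y \o cons false).
    by case: m {IH} => [|//]; rewrite /= mulr0 !scale0r.
  rewrite [X in _ = _ + X]addrC [RHS]addrACA -!scalerDl addrC.
  by congr (_ *: _ + _ *: _); rewrite ?exprS; ring.
rewrite [remove_one b _](remove_one_comb b (fun c => tsc m s.+1 c (y \o cons false))
   (fun c => tsc m.+1 s.+1 c (y \o cons true))).
rewrite -!IH scalerDr !scalerA -exprS; congr (_ + _ *: _).
by rewrite exprS; ring.
Qed.

(** The first factor [1 + z R_i] settles the first particle, at site [s + h]. The later factors,
    represented by [g], act to its right only, as a scan restarted with nothing pending. A landing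
    opens one pending jump, which [transfer_succ] turns into a departure. *)
Lemma transfer_jump s b y g : has id b ->
  (forall h e, size (nseq h false ++ true :: e) = size b -> (ones e).+1 = ones b ->
     g (nseq h false ++ true :: e) =
     tsc 0 (s + h).+1 e (fun c => y (nseq h false ++ true :: c))) ->
  tsc 0 s b y = g b + z *: jump s b g.
Proof.
elim: b s y g => [|[] b IH] s y g //= ob E.
  have /= -> := E 0%N b erefl erefl; rewrite addn0 scale0r addr0.
  rewrite mulr0 addr0 mulr1 scalerDl scale1r scalerA.
  by congr (_ + _ *: _); rewrite mulrC.
rewrite scale1r mulr1 (IH s.+1 (y \o cons false) (g \o cons false)) //=.
  rewrite scalerDr addrA; congr (_ + _); rewrite scalerA; congr (_ *: _).
  rewrite transfer_succ; apply: remove_one_ext => c sz o /=.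
  by have /= -> := E 0%N c; rewrite ?addn0 ?sz.
move=> h e sz o.
have /= -> := E h.+1 e; rewrite ?addnS //=; by rewrite -sz.
Qed.

Lemma zerosE b : ~~ has id b -> b = nseq (size b) false.
Proof. by elim: b => [|[] b IH] //= /IH {1}->. Qed.

Lemma transfer_sc_zeros m s g y :
  tsc m s (nseq g false) y = if m == 0%N then y (nseq g false) else 0.
Proof.
elim: g m s y => [|g IH] m s y //=; rewrite !IH /= scaler0 addr0.
by case: eqP => [->|_]; rewrite ?scale1r ?scaler0.
Qed.

Lemma transfer_sc_ext m s b y y' : y =1 y' -> tsc m s b y = tsc m s b y'.
Proof.
elim: b m s y y' => [|[] b IH] m s y y' E /=; first by rewrite E.
  by congr (_ *: _ + _ *: _); apply: IH => c /=.
by congr (_ *: _ + _ *: _); apply: IH => c /=.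
Qed.

(** The prefix [u] is already settled. It is empty or ends with a particle, so that all the holes
    open to the next jump are at the start of what remains. *)
Theorem prod_R_transfer (n k : nat) (R : nat -> V -> V) y u b :
  (forall i, (0 < i <= k)%N -> lin (R i)) ->
  (forall u c, last true u -> size (u ++ c) = n -> ones (u ++ c) = k -> has id c ->
     R (ones u).+1 (y (u ++ c)) = jump (size u) c (fun c' => y (u ++ c'))) ->
  last true u -> size (u ++ b) = n -> ones (u ++ b) = k ->
  foldl (fun v i => v + z *: R i v) (y (u ++ b)) (iota (ones u).+1 (ones b)) =
  tsc 0 (size u) b (fun c => y (u ++ c)).
Proof.
move=> lR Rj; move: {2}(ones b) (erefl (ones b)) => m; elim: m u b => [|m IH] u b om lu sz ok.
  rewrite om /= (@zerosE b) ?transfer_sc_zeros //.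
  by rewrite has_count om.
have hb : has id b by rewrite has_count om.
rewrite om /= Rj //.
pose L v := foldl (fun v i => v + z *: R i v) v (iota (ones u).+2 m).
have lL : lin L.
  apply: (@lin_foldl _ _ _ (fun i v => v + z *: R i v)) => i; rewrite mem_iota => im.
  apply: lin_add; first exact: lin_id.
  by apply/lin_scale/lR; rewrite count_cat in ok; lia.
rewrite -/(L _) (linD lL) (linZ lL) (jump_lin _ _ _ lL).
apply/esym; apply: transfer_jump => // h e sze oe.
have E c : u ++ nseq h false ++ true :: c = (u ++ nseq h false ++ [:: true]) ++ c.
  by rewrite -!catA.
have oh : ones (u ++ nseq h false ++ [:: true]) = (ones u).+1.
  by rewrite !count_cat count_nseq /= addn0 add0n addn1.
rewrite /comp /L E -oh (_ : m = ones e); last by lia.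
rewrite IH //.
- rewrite !size_cat size_nseq /= addn1 addnS; apply: transfer_sc_ext => c.
  by rewrite -E.
- by lia.
- by rewrite !last_cat.
- by rewrite -E size_cat sze -size_cat.
by rewrite -E; move: ok; rewrite !count_cat count_nseq /=; lia.
Qed.

End Jumps.

(** * Configurations *)

Section Configurations.
Implicit Types b c : seq bool.

(** Since the ones sit at the numbers [nu_i + k + 1 - i], the zeros to the right of the [i]-th one
    number [nu_i]. *)
Fixpoint rows b : seq nat :=
  match b with
  | [::] => [::]
  | true :: c => zeros c :: rows c
  | false :: c => rows c
  end.

Lemma size_rows b : size (rows b) = ones b.
Proof. by elim: b => [|[] b IH] //=; rewrite IH. Qed.

Lemma rows_cat b c : rows (b ++ c) = [seq (a + zeros c)%N | a <- rows b] ++ rows c.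
Proof. by elim: b => [|[] b IH] //=; rewrite IH count_cat. Qed.

Lemma ones_zeros b : (ones b + zeros b)%N = size b.
Proof. exact: (count_predC id). Qed.

Lemma nth_rows_le b i : (nth 0%N (rows b) i <= zeros b)%N.
Proof.
elim: b i => [|[] b IH] i /=; first by rewrite nth_nil.
  by case: i => [|i] //=; rewrite add0n.
by apply: leq_trans (IH i) _; rewrite leq_addl.
Qed.

Lemma nth_rows_mono b i j : (i <= j)%N -> (nth 0%N (rows b) j <= nth 0%N (rows b) i)%N.
Proof.
elim: b i j => [|[] b IH] i j ij /=; first by rewrite !nth_nil.
  case: i j ij => [|i] [|j] //= ij; last exact: IH.
  exact: nth_rows_le.
exact: IH.
Qed.

(** The pairs of a zero preceding a one: the number of moves from [10] to [01] separating [b] from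
    the sorted string. *)
Fixpoint config_inv b : nat :=
  match b with
  | [::] => 0%N
  | true :: c => config_inv c
  | false :: c => (ones c + config_inv c)%N
  end.

Lemma config_top_or_inv b :
  b = nseq (ones b) true ++ nseq (zeros b) false \/
  exists pre post, b = pre ++ [:: false, true & post].
Proof.
elim: b => [|[] b IH]; first by left.
  case: IH => [{1}->|[pre [post ->]]]; first by left.
  by right; exists (true :: pre), post.
case: IH => [E|[pre [post ->]]]; last by right; exists (false :: pre), post.
case: b E => [|[] b] E; first by left.
  by right; exists [::], b.
left; move: E => /=; case: (ones b) => [|o] //= -[{1}->].
by rewrite add0n.
Qed.

(** The induction starts at the largest partition, where all particles come first and the scan
    reduces to the product of the [1 + z x_i]. *)
Lemma config_ind (P : seq bool -> Prop) n k :
  P (nseq k true ++ nseq (n - k) false) ->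
  (forall pre post, size (pre ++ [:: true, false & post]) = n ->
     ones (pre ++ [:: true, false & post]) = k ->
     P (pre ++ [:: true, false & post]) -> P (pre ++ [:: false, true & post])) ->
  forall b, size b = n -> ones b = k -> P b.
Proof.
move=> P0 Ps b; have [m] := ubnP (config_inv b); elim: m b => // m IH b lm sz ob.
have [Eb|[pre [post Eb]]] := config_top_or_inv b.
  by rewrite Eb ob -(_ : n - k = zeros b)%N // -sz -ob -ones_zeros addKn.
move: lm sz ob; rewrite Eb => lm sz ob.
have sz' : size (pre ++ [:: true, false & post]) = n by rewrite -sz !size_cat.
have ob' : ones (pre ++ [:: true, false & post]) = k by rewrite -ob !count_cat.
apply: Ps => //; apply: IH => //; rewrite -ltnS; apply: leq_trans lm.
rewrite ltnS; elim: (pre) => [|[] pre' IHp] //=.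
by rewrite !count_cat /=; lia.
Qed.

End Configurations.

(** * Configurations and the permutations [w_nu] *)

Section Grassmannian.
Variables n k : nat.
Hypothesis kn : (k <= n)%N.
Implicit Types (b c pre post : seq bool) (w : 'S_n).

Definition part_of b : part n k := [ffun r : 'I_k => inord (nth 0%N (rows b) r)].

Definition config b := (size b == n) && (ones b == k).

Lemma configP b : config b -> [/\ size b = n, ones b = k & zeros b = (n - k)%N].
Proof. by case/andP=> /eqP sz /eqP o; split=> //; have := ones_zeros b; lia. Qed.

Lemma part_ofE b (r : 'I_k) : config b -> part_of b r = nth 0%N (rows b) r :> nat.
Proof.
by case/configP=> _ _ zb; rewrite ffunE inordK // ltnS -zb nth_rows_le.
Qed.

Lemma is_part_of b : config b -> is_part (part_of b).
Proof.
move=> cb; apply/forallP => i; apply/forallP => j; apply/implyP => ij.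
by rewrite !part_ofE // nth_rows_mono.
Qed.

Lemma config_swap pre post a a' :
  config (pre ++ [:: a, a' & post]) = config (pre ++ [:: a', a & post]).
Proof. by rewrite /config !size_cat !count_cat /= [(a + _)%N]addnCA. Qed.

Lemma pwE w (a : 'I_n) : pw w a.+1 = (w a).+1.
Proof. by rewrite /pw /= valK. Qed.

(** The quotient of two candidates fixes the first [k] positions and increases on the others, so it
    is the identity. *)
Lemma is_wnu_uniq (nu : part n k) w w' : is_wnu nu w -> is_wnu nu w' -> w = w'.
Proof.
move=> /andP [/forallP e /forallP m] /andP [/forallP e' /forallP m'].
have eq_lt (a : 'I_n) : (a < k)%N -> w a = w' a.
  move=> ak; have ik : (k - a.+1 < k)%N by lia.
  have := e (Ordinal ik); rewrite -(eqP (e' (Ordinal ik))) /=.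
  have -> : (k - (k - a.+1) = a.+1)%N by lia.
  by rewrite !pwE => /eqP [/val_inj].
have inc (u : 'S_n) : (forall a : 'I_n, [forall b : 'I_n,
    ((k <= a)%N && (a < b)%N) ==> (u a < u b)%N]) ->
    forall a b : 'I_n, (k <= a)%N -> (a < b)%N -> (u a < u b)%N.
  by move=> H a b ka ab; have /forallP/(_ b) := H a; rewrite ka ab.
pose s := (w' * w^-1)%g.
have sE a : w (s a) = w' a by rewrite /s permM permKV.
have s_lt (a : 'I_n) : (a < k)%N -> s a = a.
  by move=> ak; apply: (@perm_inj _ w); rewrite sE eq_lt.
have s_ge (a : 'I_n) : (k <= a)%N -> (k <= s a)%N.
  move=> ka; rewrite leqNgt; apply/negP => lt.
  by have /perm_inj E := s_lt _ lt; rewrite E in lt; lia.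
suff : s = 1%g by move=> s1; rewrite -[w']mulg1 -(mulVg w) mulgA -/s s1 mul1g.
apply: increasing_perm1 => i j ji.
have [jk|kj] := ltnP j k; first by rewrite !s_lt //; lia.
have [ik|ki] := ltnP i k; first by rewrite (s_lt i ik); apply: leq_trans (s_ge _ kj).
have lt : (w' i < w' j)%N by apply: (inc w' m') => //; lia.
rewrite -!sE in lt; rewrite ltnNge; apply/negP.
rewrite leq_eqVlt => /orP [/eqP/val_inj E|/(inc w m) gt].
  by rewrite E ltnn in lt.
by have := gt (s_ge _ kj); lia.
Qed.

(** Site [s] stands for the value [n - 1 - s], counted from 0, and is occupied when that value is
    taken at one of the first [k] positions. Growth on both blocks makes [w] the shortest element of
    its coset modulo [S_k x S_(n-k)]. *)
Definition grassmann b w :=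
  (forall a : 'I_n, nth false b (n.-1 - w a) = (a < k)%N) /\
  (forall a c : 'I_n, (a < c)%N -> (a < k)%N = (c < k)%N -> (w a < w c)%N).

Lemma grassmann_top : exists w, let b := nseq k true ++ nseq (n - k) false in
  grassmann b w /\ is_wnu (part_of b) w.
Proof.
(* For the largest partition the first [k] positions take the [k] largest values in order. *)
pose f (a : 'I_n) : 'I_n := insubd a (if (a < k)%N then (a + (n - k))%N else (a - k)%N).
have fE (a : 'I_n) : f a = (if (a < k)%N then (a + (n - k))%N else (a - k)%N) :> nat.
  by rewrite /f val_insubd; have := ltn_ord a; case: ifP => //; case: ifP; lia.
have f_inj : injective f.
  move=> a c /(congr1 val) /=; rewrite !fE => E; apply: val_inj; move: E => /=.
  by have := ltn_ord a; have := ltn_ord c; case: ifP; case: ifP; lia.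
exists (perm f_inj) => b.
have cb : config b.
  by rewrite /config size_cat !size_nseq count_cat !count_nseq /= mul1n mul0n addn0; lia.
split; first split.
- move=> a; rewrite permE fE nth_cat size_nseq !nth_nseq; have an := ltn_ord a.
  have [ak|ka] := ltnP a k.
    by have -> : (n.-1 - (a + (n - k)) < k)%N by lia.
  by rewrite (_ : _ < k = false)%N ?if_same //; lia.
- move=> a c ac e; rewrite !permE !fE e; case: ifP => ck; first by lia.
  by rewrite ck in e; lia.
apply/andP; split.
  apply/forallP => i; have an : (k - i.+1 < n)%N by have := ltn_ord i; lia.
  have -> : (k - i = (Ordinal an).+1)%N by rewrite /=; have := ltn_ord i; lia.
  rewrite pwE permE fE part_ofE //= rows_cat (_ : rows (nseq (n - k) false) = [::]).
    rewrite cats0 count_nseq mul1n.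
    have -> : rows (nseq k true) = nseq k 0%N.
      by elim: (k) => //= j ->; rewrite count_nseq.
    rewrite (nth_map 0%N) ?size_nseq ?nth_nseq ?ltn_ord //.
    by have := ltn_ord i; case: ifP; lia.
  by elim: (n - k)%N.
apply/forallP => a; apply/forallP => c; apply/implyP => ac.
by rewrite !permE !fE; case: ifP; case: ifP; lia.
Qed.

(** The exchanged neighbouring values lie in different blocks, so no comparison within a block
    changes, and a single row drops by one. *)
Lemma grassmann_step pre post w (lo hi : 'I_n) :
  let b := pre ++ [:: true, false & post] in
  let b' := pre ++ [:: false, true & post] in
  config b -> lo = size post :> nat -> hi = lo.+1 :> nat ->
  grassmann b w -> is_wnu (part_of b) w ->
  grassmann b' (w * sref n hi)%g /\ is_wnu (part_of b') (w * sref n hi)%g.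
Proof.
move=> b b' cb lo_p hl [bits mono] wn.
have [sz ob zb] := configP cb.
have cb' : config b' by rewrite /b' config_swap.
have szE : (size pre + (size post).+2)%N = n by rewrite -sz size_cat.
have nswap (v : 'I_n) : nth false b' (n.-1 - tperm lo hi v) = nth false b (n.-1 - v).
  case: tpermP => [->|->|/eqP + /eqP +].
  - have -> : (n.-1 - hi = size pre)%N by lia.
    have -> : (n.-1 - lo = (size pre).+1)%N by lia.
    by rewrite /b /b' !nth_cat ltnn subnn ltnNge leqnSn subSnn.
  - have -> : (n.-1 - hi = size pre)%N by lia.
    have -> : (n.-1 - lo = (size pre).+1)%N by lia.
    by rewrite /b /b' !nth_cat ltnn subnn ltnNge leqnSn subSnn.
  rewrite -!val_eqE /= => vl vh; rewrite /b /b' !nth_cat.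
  case: ifP => // ge; have vn := ltn_ord v.
  by case E : (n.-1 - v - size pre)%N => [|[|e]] //; lia.
have hi_bit (a : 'I_n) : w a = hi -> (a < k)%N.
  move=> E; rewrite -bits E (_ : n.-1 - hi = size pre)%N; last by lia.
  by rewrite /b nth_cat ltnn subnn.
have lo_bit (a : 'I_n) : w a = lo -> (a < k)%N = false.
  move=> E; rewrite -bits E (_ : n.-1 - lo = (size pre).+1)%N; last by lia.
  by rewrite /b nth_cat ltnNge leqnSn subSnn.
have mono' (a c : 'I_n) : (a < c)%N -> (a < k)%N = (c < k)%N ->
    ((w * sref n hi)%g a < (w * sref n hi)%g c)%N.
  move=> ac e; rewrite (srefE hl) !permM; have := mono a c ac e.
  case: tpermP => [Ea|Ea|/eqP + /eqP +]; case: tpermP => [Ec|Ec|/eqP + /eqP +];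
    rewrite -?val_eqE /= ?Ea ?Ec; try lia.
  by have := hi_bit _ Ec; rewrite -e (lo_bit _ Ea).
split; first by split=> // a; rewrite (srefE hl) permM nswap.
apply/andP; split; last first.
  apply/forallP => a; apply/forallP => c; apply/implyP => /andP [ka ac].
  by apply: mono' => //; lia.
have obE : (ones pre + (ones post).+1)%N = k by rewrite -ob count_cat /= add1n add0n.
have pz := ones_zeros post.
move: wn => /andP [/forallP wn _].
have wE (i : 'I_k) (a : 'I_n) : (a + i.+1 = k)%N -> (w a = nth 0%N (rows b) i + a :> nat)%N.
  move=> E; have := wn i; rewrite (_ : k - i = a.+1)%N; last by lia.
  by rewrite pwE part_ofE // => /eqP; lia.
have nth_r : nth 0%N (rows b) (ones pre) = (zeros post).+1.
  by rewrite /b rows_cat nth_cat size_map size_rows ltnn subnn /= add1n.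
(* Row [ones pre], counted from 0, belongs to position [k - 1 - ones pre = ones post]; its value
   drops from [hi] to [lo]. *)
have wr (a : 'I_n) : a = ones post :> nat -> w a = hi.
  move=> Ea; have rk : (ones pre < k)%N by lia.
  by apply: val_inj; rewrite /= (wE (Ordinal rk)) /= ?nth_r; lia.
apply/forallP => i; have ik := ltn_ord i; have an : (k - i.+1 < n)%N by lia.
have aE : (k - i = (Ordinal an).+1)%N by rewrite /=; lia.
have ai : (Ordinal an + i.+1 = k)%N by rewrite /=; lia.
rewrite aE pwE part_ofE // (srefE hl) permM; apply/eqP; rewrite addnS; congr _.+1.
have [ir|ir] := eqVneq (nat_of_ord i) (ones pre).
  rewrite wr /= ?tpermR; last by lia.
  by rewrite ir /b' rows_cat nth_cat size_map size_rows ltnn subnn /=; lia.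
rewrite tpermD.
- rewrite (wE i) //; congr (_ + _)%N; rewrite /b /b' !rows_cat !nth_cat !size_map /=.
  rewrite !add1n !add0n; case: ifP => //; rewrite size_rows => ri.
  by case E : (i - ones pre)%N => [|e] //; lia.
- apply/eqP => E; have := lo_bit _ (esym E); rewrite /=; lia.
have on : (ones post < n)%N by lia.
apply/eqP; rewrite -(wr (Ordinal on)) // => /perm_inj /(congr1 val) /= E.
by lia.
Qed.

Lemma grassmann_wnu b : config b ->
  grassmann b (wnu (part_of b)) /\ is_wnu (part_of b) (wnu (part_of b)).
Proof.
case/andP=> /eqP sz /eqP ob.
suff [w [gw ww]] : exists w, grassmann b w /\ is_wnu (part_of b) w.
  rewrite /wnu; case: pickP => [w' ww' /=|/(_ w)]; last by rewrite ww.
  by rewrite (is_wnu_uniq ww' ww).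
move: b sz ob; apply: config_ind => [|pre post sz ob [w [gw ww]]].
  exact: grassmann_top.
move: (sz); rewrite size_cat /= => szE.
have lo_n : (size post < n)%N by lia.
have hi_n : ((size post).+1 < n)%N by lia.
exists (w * sref n (Ordinal hi_n))%g.
by apply: (@grassmann_step _ _ _ (Ordinal lo_n)) => //; rewrite /config sz ob !eqxx.
Qed.

Lemma wnu_step pre post (lo hi : 'I_n) : config (pre ++ [:: true, false & post]) ->
  lo = size post :> nat -> hi = lo.+1 :> nat ->
  wnu (part_of (pre ++ [:: false, true & post])) =
  (wnu (part_of (pre ++ [:: true, false & post])) * sref n hi)%g.
Proof.
move=> cb lop hl; have [gw ww] := grassmann_wnu cb.
have [_ ww'] := grassmann_step cb lop hl gw ww.
by apply: is_wnu_uniq ww'; case: (@grassmann_wnu (pre ++ [:: false, true & post]));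
  rewrite // config_swap.
Qed.

End Grassmannian.

(** * Symmetrized operators *)

Section Symmetrizer.
Variables (F : fieldType) (V : lmodType F) (n k : nat) (p q hbar : F) (t : nat -> F).
Variables (T x : nat -> V -> V) (Y : 'S_n -> V) (ev : V -> F).
Hypothesis kn : (k <= n)%N.
Hypothesis rep : schubert_rep p q hbar t T x Y ev.
Implicit Types (w v : 'S_n) (b c pre post : seq bool).

Let lT := T_lin rep.

Definition red_word w : seq nat := xchoose (reduced_exists w).

Lemma red_wordP w : reduced_word (red_word w) w.
Proof. exact: (xchooseP (reduced_exists w)). Qed.

Definition T_perm w (u : V) := T_word T (red_word w) u.

Lemma T_permE w s u : reduced_word s w -> T_perm w u = T_word T s u.
Proof.
move=> rs; rewrite /T_perm.
exact: (matsumoto (T_braid rep) (T_far rep) (red_wordP w) rs).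
Qed.

Lemma lin_T_perm w : lin (T_perm w).
Proof.
by have /andP [/andP [al _] _] := red_wordP w; apply: lin_T_word al.
Qed.

(** [Y w] with its base vector [Y (w0 n)] left free. *)
Definition Y_op w := T_perm (w0 n * w^-1)%g.

Lemma lin_Y_op w : lin (Y_op w).
Proof. exact: lin_T_perm. Qed.

Lemma Y_op_w0 w : Y_op w (Y (w0 n)) = Y w.
Proof. exact: esym (Y_def rep (red_wordP _)). Qed.

(** A generator on the right of [w^-1 w0] becomes its conjugate by [w0] on the left of [w], whence
    the index [n - hi]. *)
Lemma Y_op_T_desc w (lo hi : 'I_n) u : hi = lo.+1 :> nat ->
  (w^-1%g hi < w^-1%g lo)%N -> Y_op w (T (n - hi)%N u) = Y_op (w * sref n hi)%g u.
Proof.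
move=> hl d; rewrite /Y_op.
have hE (a : 'I_n) : w0 n a = rev_ord a by rewrite permE.
have ba : rev_ord lo = (rev_ord hi).+1 :> nat.
  by rewrite /=; have := ltn_ord hi; lia.
have -> : (n - hi = rev_ord lo)%N by rewrite /=; have := ltn_ord hi; lia.
have -> : (w0 n * (w * sref n hi)^-1 = sref n (rev_ord lo) * (w0 n * w^-1))%g.
  rewrite invMg srefV !mulgA; congr (_ * _)%g.
  have : (tperm lo hi ^ w0 n = tperm (rev_ord hi) (rev_ord lo))%g.
    by rewrite tpermJ !hE tpermC.
  rewrite -(srefE hl) -(srefE ba) => <-.
  by rewrite conjgE w0V -!mulgA w0_invol mulg1.
rewrite (T_permE _ (reduced_rcons ba _ (red_wordP _))).
  by rewrite -cats1 T_word_cat.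
by rewrite !permM !hE !rev_ordK.
Qed.

Lemma Y_op_T_asc w (lo hi : 'I_n) u : hi = lo.+1 :> nat ->
  (w^-1%g lo < w^-1%g hi)%N ->
  Y_op w (T (n - hi)%N u) = (q - p) *: Y_op w u + (p * q) *: Y_op (w * sref n hi)%g u.
Proof.
move=> hl a; set w' := (w * sref n hi)%g.
have E u' : Y_op w u' = Y_op w' (T (n - hi)%N u').
  rewrite (Y_op_T_desc _ hl); first by rewrite /w' -mulgA sref_invol mulg1.
  by have [-> ->] := mul_srefE w hl.
have jn : (0 < n - hi < n)%N by have := ltn_ord hi; lia.
by rewrite !E (T_sq rep) // (linD (lin_Y_op _)) !(linZ (lin_Y_op _)).
Qed.

Lemma young_mem v a : young k v -> (v a < k)%N = (a < k)%N.
Proof. by move=> /forallP /(_ a) /eqP ->. Qed.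

Lemma youngV v : young k v -> young k v^-1%g.
Proof. by move=> yv; apply/forallP => a; rewrite -{1}(permKV v a) young_mem. Qed.

Lemma youngM v v' : young k v -> young k v' -> young k (v * v')%g.
Proof. by move=> yv yv'; apply/forallP => a; rewrite permM !young_mem. Qed.

Lemma young_sref (i j : 'I_n) : j = i.+1 :> nat -> nat_of_ord j != k -> young k (sref n j).
Proof.
move=> ji jk; apply/forallP => a; rewrite (srefE ji).
by case: tpermP => [->|->|//]; lia.
Qed.

(** [Y_nu] with its base vector left free. The value 0 elsewhere gives a linear operator for every
    bit string, as the lemmas on [transfer] demand. *)
Definition Ynu_op b (u : V) : V :=
  if config n k b then
    \sum_(v | young k v) p ^+ perm_length v *: Y_op (v * wnu (part_of n k b))%g u
  else 0.

Lemma lin_Ynu_op b : lin (Ynu_op b).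
Proof.
rewrite /Ynu_op; case: (config n k b); last exact: lin_zero.
apply: (@lin_sum F V _ _ _ (fun v u => _ *: Y_op (v * _)%g u)) => v _.
exact/lin_scale/lin_Y_op.
Qed.

Lemma Ynu_op_w0 b : config n k b -> Ynu_op b (Y (w0 n)) = Ynu p Y (part_of n k b).
Proof.
by move=> cb; rewrite /Ynu_op cb; apply: eq_bigr => v _; rewrite Y_op_w0.
Qed.

Lemma split_index pre post (a a' : bool) : config n k (pre ++ [:: a, a' & post]) ->
  exists lo hi : 'I_n, [/\ lo = size post :> nat, hi = lo.+1 :> nat,
    (size pre).+1 = (n - hi)%N, (n.-1 - hi = size pre)%N & (n.-1 - lo = (size pre).+1)%N].
Proof.
case/configP=> // + _ _; rewrite size_cat /= => sz.
have lo_n : (size post < n)%N by lia.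
have hi_n : ((size post).+1 < n)%N by lia.
by exists (Ordinal lo_n), (Ordinal hi_n); split=> //=; lia.
Qed.

(** The value [hi] is held in the first block and [lo] in the second, and [v] preserves blocks.
    Every term is thus in the descent case and the quadratic relation does not intervene. *)
Lemma Ynu_op_swap pre post u : size (pre ++ [:: true, false & post]) = n ->
  Ynu_op (pre ++ [:: true, false & post]) (T (size pre).+1 u) =
  Ynu_op (pre ++ [:: false, true & post]) u.
Proof.
move=> sz; rewrite /Ynu_op [in RHS]config_swap; case: ifP => // cb.
have [lo [hi [lop hl tE hiE loE]]] := split_index cb; rewrite tE.
have [[bits _] _] := grassmann_wnu kn cb.
rewrite (wnu_step kn cb lop hl); apply: eq_bigr => v yv; congr (_ *: _).
rewrite (Y_op_T_desc _ hl) ?mulgA //.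
set w := wnu _ in bits *; rewrite invMg !permM.
have ge : (k <= v^-1%g (w^-1%g lo))%N.
  rewrite leqNgt young_mem ?youngV // -bits permKV loE nth_cat ltnNge leqnSn.
  by rewrite subSnn.
apply: leq_trans ge; rewrite young_mem ?youngV // -bits permKV hiE nth_cat ltnn.
by rewrite subnn.
Qed.

(** Two adjacent values in one block sit at adjacent positions, so [s_hi w = w s_j] and the terms
    pair up as [v] and [s_j v]. With [A], [B] the operators of such a pair, the eigenvalue comes
    from [(q - p) A + p q B + p A = q (A + p B)]. *)
Lemma Ynu_op_eq a pre post u : size (pre ++ [:: a, a & post]) = n ->
  Ynu_op (pre ++ [:: a, a & post]) (T (size pre).+1 u) = q *: Ynu_op (pre ++ [:: a, a & post]) u.
Proof.
move=> sz; rewrite /Ynu_op; case: ifP => cb; last by rewrite scaler0.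
have [lo [hi [lop hl tE hiE loE]]] := split_index cb; rewrite tE.
have [[bits mono] _] := grassmann_wnu kn cb.
set w := wnu _ in bits mono *.
pose i := w^-1%g lo; pose j := w^-1%g hi.
have wi : w i = lo by rewrite /i permKV.
have wj : w j = hi by rewrite /j permKV.
have ij : i != j by apply/eqP => E; move: hl; rewrite -wi -wj E; lia.
have bij : (i < k)%N = (j < k)%N.
  rewrite -!bits wi wj hiE loE !nth_cat ltnn subnn ltnNge leqnSn.
  by rewrite subSnn.
have lt_ij : (i < j)%N.
  rewrite ltnNge leq_eqVlt; apply/negP => /orP [/eqP/val_inj E|ji].
    by rewrite E eqxx in ij.
  by have := mono _ _ ji (esym bij); rewrite wi wj; lia.
(* By monotonicity a position strictly between would hold a value strictly between [lo] and [hi]. *)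
have ji : j = i.+1 :> nat.
  apply/eqP; rewrite eqn_leq lt_ij andbT leqNgt; apply/negP => lt.
  have cn : (i.+1 < n)%N by have := ltn_ord j; lia.
  have := mono i (Ordinal cn) (ltnSn _); have := mono (Ordinal cn) j lt.
  by rewrite wi wj /=; move: bij lt; case: ltnP; case: ltnP; case: ltnP; lia.
have ws : (sref n j * w = w * sref n hi)%g.
  have : (tperm i j ^ w = tperm lo hi)%g by rewrite tpermJ wi wj.
  by rewrite (srefE ji) (srefE hl) conjgE => <-; rewrite !mulgA mulgV mul1g.
have jk : nat_of_ord j != k.
  by apply/eqP => E; move: bij; case: ltnP; case: ltnP; lia.
have ysw v : young k (v * sref n j)%g = young k v.
  have ys := young_sref ji jk.
  apply/idP/idP => y; last exact: youngM.
  by rewrite -[v]mulg1 -(sref_invol n j) mulgA; apply: youngM.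
pose up v := (v^-1%g i < v^-1%g j)%N.
have upN v : up (v * sref n j)%g = ~~ up v.
  rewrite /up; have [-> ->] := mul_srefE v ji.
  have vij : v^-1%g i != v^-1%g j by rewrite (inj_eq perm_inj).
  by move: vij; rewrite -val_eqE /=; lia.
pose f v u := p ^+ perm_length v *: Y_op (v * w)%g u.
have pair u' : \sum_(v | young k v) f v u' =
    \sum_(v | young k v && up v) (f v u' + f (v * sref n j)%g u').
  rewrite (bigID up) /= big_split /=; congr (_ + _).
  rewrite (reindex_inj (mulIg (sref n j))) /=; apply: eq_bigl => v.
  by rewrite ysw upN negbK.
rewrite -/(\sum_(v | young k v) f v (T (n - hi)%N u)) -/(\sum_(v | young k v) f v u).
rewrite !pair scaler_sumr; apply: eq_bigr => v /andP [yv uv].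
have vw : ((v * w)^-1%g lo < (v * w)^-1%g hi)%N.
  by rewrite invMg !permM.
rewrite /f (length_mul_sref ji uv) -mulgA ws mulgA (Y_op_T_asc _ hl vw).
rewrite (Y_op_T_desc _ hl); last by have [-> ->] := mul_srefE (v * w)%g hl.
rewrite -[(v * w * sref n hi * sref n hi)%g]mulgA sref_invol mulg1.
rewrite !scalerDr !scalerA addrAC -scalerDl exprSr; congr (_ *: _ + _ *: _); ring.
Qed.

Variable z : F.

Definition gen_op (u : V) := foldl (fun u i => u + z *: x i.+1 u) u (iota 0 k).

(** For [i < k], [T_i] commutes with the sum and the product of [x_i] and [x_(i+1)]; for [i > k]
    neither variable occurs. *)
Lemma gen_op_T i u : (0 < i < n)%N -> i != k -> gen_op (T i u) = T i (gen_op u).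
Proof.
move=> i_n ik; have li := lT i_n.
have far j u' : (j < n)%N -> j.+1 != i -> j != i ->
    T i u' + z *: x j.+1 (T i u') = T i (u' + z *: x j.+1 u').
  move=> jn ji ji'; rewrite (linD li) (linZ li) (Tx_comm rep) //; lia.
have fars j m u' : (j + m <= n)%N -> ((j + m < i) || (i < j))%N ->
    foldl (fun u i => u + z *: x i.+1 u) (T i u') (iota j m) =
    T i (foldl (fun u i => u + z *: x i.+1 u) u' (iota j m)).
  elim: m j u' => [|m IH] j u' jm ij //=; rewrite far ?IH //; lia.
rewrite /gen_op; have [ki|lt] := ltnP k i.
  by rewrite fars //; lia.
case: i i_n ik li far fars lt => // i i_n ik li far fars lt.
have -> : k = (i + (2 + (k - i.+2)))%N by lia.
rewrite iotaD foldl_cat [in RHS]foldl_cat add0n.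
rewrite fars; [|lia..]; move: (foldl _ u _) => u1.
rewrite iotaD !foldl_cat -fars; [|lia..]; congr foldl.
rewrite /=; have lx0 : lin (x i.+1) by apply: (x_lin rep); lia.
have lx1 : lin (x i.+2) by apply: (x_lin rep); lia.
rewrite !(linD li) !(linZ li) !(linD lx1) !(linZ lx1) !(linD li) !(linZ li).
have Tx0 := Tx_i rep i_n; have Tx1 := Tx_i1 rep i_n.
have xx u' : x i.+2 (x i.+1 u') = x i.+1 (x i.+2 u') by apply: (x_comm rep); lia.
have -> : T i.+1 (x i.+2 (x i.+1 u1)) = x i.+2 (x i.+1 (T i.+1 u1)).
  rewrite xx Tx0 Tx1 (linB lx1) (linB lx1) !(linZ lx1) !xx.
  by rewrite subrK.
have sumT : T i.+1 (x i.+1 u1) + T i.+1 (x i.+2 u1) = x i.+1 (T i.+1 u1) + x i.+2 (T i.+1 u1).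
  by rewrite Tx0 Tx1 addrACA subrr addr0 addrC.
by rewrite -!addrA -!scalerDr !addrA sumT.
Qed.

Lemma gen_op_T_perm w u : young k w -> gen_op (T_perm w u) = T_perm w (gen_op u).
Proof.
move=> yw.
have [s rs al] : exists2 s, reduced_word s w & all (fun a => a != k) s.
  apply: (@reduced_exists_in n (fun w => young k w)) => // w' yw' w1.
  have [|i [j [ji d]]] := @exists_desc n w'^-1%g.
    by apply: contra w1 => /eqP E; rewrite -(invgK w') E invg1.
  have jk : nat_of_ord j != k.
    apply/eqP => jk; have := young_mem i (youngV yw'); have := young_mem j (youngV yw').
    by case: ltnP; case: ltnP; case: ltnP; case: ltnP; lia.
  by exists i, j; split=> //; apply/youngM/(young_sref ji jk).
rewrite !(T_permE _ rs); have /andP [/andP [ln _] _] := rs.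
elim: s {rs} al ln => [|a s IH] //= /andP [ak al] /andP [an ln].
by rewrite gen_op_T // IH.
Qed.

Lemma lin_gen_op : lin gen_op.
Proof.
apply: (@lin_foldl _ _ _ (fun i u => u + z *: x i.+1 u)) => i; rewrite mem_iota => im.
apply: lin_add; first exact: lin_id.
by apply/lin_scale/(x_lin rep); lia.
Qed.

(** Here [w_nu], like [w0], sends the first [k] positions to the [k] largest values, so [w_nu^-1 w0]
    preserves the blocks and every term commutes with [gen_op]. *)
Lemma gen_op_Ynu_op_top u : let b := nseq k true ++ nseq (n - k) false in
  gen_op (Ynu_op b u) = Ynu_op b (gen_op u).
Proof.
move=> b; have cb : config n k b.
  by rewrite /config size_cat !size_nseq count_cat !count_nseq /= mul1n mul0n addn0; lia.
have [[bits _] _] := grassmann_wnu kn cb.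
rewrite /Ynu_op cb (big_morph gen_op (linD lin_gen_op) (lin0 lin_gen_op)).
apply: eq_bigr => v yv; rewrite (linZ lin_gen_op); congr (_ *: _).
rewrite /Y_op gen_op_T_perm // invMg mulgA; apply: youngM (youngV yv).
apply/forallP => a; rewrite permM -(bits (_ (w0 n a))) permKV permE /=.
have an := ltn_ord a; rewrite (_ : n.-1 - (n - a.+1) = a)%N; last by lia.
by rewrite nth_cat size_nseq !nth_nseq; case: ltnP; rewrite ?if_same.
Qed.

Theorem gen_op_Ynu_op b u : config n k b ->
  gen_op (Ynu_op b u) = transfer p q hbar z (fun s => x s.+1) 0 0 b Ynu_op u.
Proof.
case/andP=> /eqP sb /eqP ob; move: b sb ob u.
apply: config_ind => [|pre post sz ob IH] u; first by rewrite gen_op_Ynu_op_top transfer_top.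
move: (sz); rewrite size_cat /= => szE.
have i_n : (0 < (size pre).+1 < n)%N by lia.
rewrite -(Ynu_op_swap _ sz) IH.
apply: (@transfer_exchange _ _ _ _ _ _ _ n (size pre)) => //; try lia.
- by move=> s sn; apply: (x_lin rep); lia.
- exact: lT.
- by move=> v; apply: (T_sq rep).
- exact: (Tx_i rep).
- exact: (Tx_i1 rep).
- by move=> v; apply: (x_comm rep); lia.
- by move=> s sn s1 s2 v; rewrite (Tx_comm rep) //; lia.
- exact: lin_Ynu_op.
- move=> c d v sc sd; rewrite -sc Ynu_op_swap // -sz !size_cat /= sc sd; lia.
- move=> a c d v sc sd; rewrite -sc Ynu_op_eq // -sz !size_cat /= sc sd; lia.
Qed.

Theorem gen_op_Ynu b : config n k b ->
  gen_op (Ynu p Y (part_of n k b)) =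
  transfer_sc p q hbar z (fun s => t (n - s)%N) 0 0 b
    (fun c => if config n k c then Ynu p Y (part_of n k c) else 0).
Proof.
move=> cb; rewrite -Ynu_op_w0 // gen_op_Ynu_op //.
have [sb _ _] := configP kn cb.
rewrite (@transfer_eigen _ _ _ _ _ _ _ n (fun s => t (n - s)%N)).
- apply: transfer_sc_ext => c; case: ifP => [/Ynu_op_w0 //|nc].
  by rewrite /Ynu_op nc.
- by move=> s sn; apply: (x_lin rep); lia.
- by move=> s sn; rewrite (x_Y_w0 rep (Ordinal sn)).
- exact: lin_Ynu_op.
by rewrite add0n sb.
Qed.

End Symmetrizer.

(** * Ribbons *)

Section Ribbons.
Local Open Scope nat_scope.
Variables n k : nat.
Implicit Types nu mu : part n k.

Lemma prowE nu (r : 'I_k) : prow nu r.+1 = nu r.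
Proof. by rewrite /prow /= valK. Qed.

Lemma prow_le nu r : prow nu r <= n - k.
Proof. by rewrite /prow; case: insub => //= i; rewrite -ltnS ltn_ord. Qed.

Lemma prow_eqP nu mu : (forall r, r < k -> prow nu r.+1 = prow mu r.+1) -> nu = mu.
Proof.
move=> E; apply/ffunP => r; apply: val_inj; have := E r (ltn_ord r).
by rewrite !prowE.
Qed.

Lemma is_partP nu :
  reflect (forall r, r.+1 < k -> prow nu r.+2 <= prow nu r.+1) (is_part nu).
Proof.
apply: (iffP forallP) => [H r rk|H i].
  have := H (Ordinal (ltnW rk)) => /forallP /(_ (Ordinal rk)) /implyP /=.
  by rewrite -!prowE; apply.
apply/forallP => j; apply/implyP; rewrite -!prowE.
have := ltn_ord j; move: (nat_of_ord j) => m.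
elim: m => [|m IH] mk; first by rewrite leqn0 => /eqP ->.
rewrite leq_eqVlt => /orP [/eqP -> //|im].
by apply: leq_trans (IH (ltnW mk) im); apply: H.
Qed.

Lemma is_part_mono nu : is_part nu ->
  forall r r', r <= r' -> r' < k -> prow nu r'.+1 <= prow nu r.+1.
Proof.
move=> /is_partP H r r'; elim: r' => [|m IH]; first by rewrite leqn0 => /eqP ->.
rewrite leq_eqVlt => /orP [/eqP -> //|im] mk.
by apply: leq_trans (IH im (ltnW mk)); apply: H.
Qed.

Lemma inBE nu mu r c : r < k -> inB nu mu r.+1 c.+1 = (prow nu r.+1 <= c < prow mu r.+1).
Proof. by move=> rk; rewrite /inB /= rk. Qed.

Lemma inB_out nu mu r c : inB nu mu r.+1 c -> r < k.
Proof. by case/andP=> /andP []. Qed.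

Lemma has_boxE nu mu r : r < k -> has_box nu mu r.+1 = (prow nu r.+1 < prow mu r.+1).
Proof.
move=> rk; apply/existsP/idP => [[c]|lt]; first by rewrite inBE //; lia.
have cn : prow nu r.+1 < n - k by apply: leq_trans lt (prow_le _ _).
by exists (Ordinal cn); rewrite inBE //= leqnn.
Qed.

(* [mu / nu] is the ribbon with head [(i, e)] and tail in row [i + j]; rows and
   columns are numbered from 0 here. *)
Definition ribbon_spec nu mu i e j := forall r, r < k -> prow mu r.+1 =
  if r < i then prow nu r.+1 else if r == i then e.+1
  else if r <= i + j then (prow nu r).+1 else prow nu r.+1.

(** As [prow] counts rows from 1, [prow nu i] is the row just above the head row; the last condition
    keeps the head inside the diagram. *)
Definition ribbon_dom nu i e j :=
  [&& i + j < k, prow nu i.+1 <= e, e < n - k & (0 < i) ==> (e < prow nu i)].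

Lemma connect_invariant (A : finType) (e : rel A) (P : pred A) z z' :
  (forall a b, e a b -> P a -> P b) -> connect e z z' -> P z -> P z'.
Proof.
move=> H /connectP [s]; elim: s z => [|b s IH] z /=; first by move=> _ ->.
by case/andP=> /H Hz /IH IH' /IH' IH'' /Hz.
Qed.

(** Connectedness makes consecutive rows of the ribbon share a column, and the absence of a square
    makes them share only one: each row of [mu] below the head exceeds the row of [nu] above it by
    one. *)
Lemma ribbon_specP nu mu i : is_part nu -> i < k ->
  [&& is_part mu, is_ribbon nu mu & head_in nu mu i.+1] ->
  exists e j, ribbon_dom nu i e j /\ ribbon_spec nu mu i e j.
Proof.
move=> pn ik /and3P [pm /and4P [/forallP sub _ /forallP con /existsPn no2] /andP [hd /forallP top]].
have nle r : r < k -> prow nu r.+1 <= prow mu r.+1.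
  by move=> rk; have := sub (Ordinal rk); rewrite -!prowE.
have box0 r : r < i -> prow mu r.+1 = prow nu r.+1.
  move=> ri; have rk := ltn_trans ri ik.
  have := top (Ordinal rk); rewrite /= ltnS ri has_boxE //=.
  by have := nle r rk; lia.
rewrite has_boxE // in hd.
pose B r := (r < k) && (prow nu r.+1 < prow mu r.+1).
have exB : exists r, B r by exists i; rewrite /B ik.
have ubB r : B r -> r <= k by case/andP=> /ltnW.
have [J /andP [Jk BJ] maxJ] := ex_maxnP exB ubB.
have iJ : i <= J by apply: maxJ; rewrite /B ik.
(* A path from the head row to the last row must step down from row [r] within one column, which
   both rows then contain. *)
have join r : i <= r -> r < J -> prow nu r.+1 < prow mu r.+2.
  move=> ir rJ; rewrite ltnNge; apply/negP => gap.
  have cn s : s < k -> prow nu s.+1 < prow mu s.+1 -> prow nu s.+1 < n - k.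
    by move=> sk lt; apply: leq_trans lt (prow_le _ _).
  pose z : 'I_k * 'I_(n - k) := (Ordinal ik, Ordinal (cn _ ik hd)).
  pose z' : 'I_k * 'I_(n - k) := (Ordinal Jk, Ordinal (cn _ Jk BJ)).
  have := con z => /forallP /(_ z') /implyP.
  rewrite {1 2}/cell_in !inBE //= !leqnn hd BJ => /(_ isT) C.
  suff : z'.1 <= r by rewrite /= leqNgt rJ.
  have zr : z.1 <= r by [].
  apply: (@connect_invariant _ _ (fun a : 'I_k * 'I_(n - k) => a.1 <= r) _ _ _ C zr) => a b /=.
  rewrite /cell_in !inBE ?ltn_ord // /adj.
  move: (nat_of_ord a.1) (nat_of_ord a.2) (nat_of_ord b.1) (nat_of_ord b.2).
  move=> a1 a2 b1 b2 /and3P [ca cb ab] ar; rewrite leqNgt; apply/negP => br.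
  have [E2 [Ea Eb]] : a2 = b2 /\ a1 = r /\ b1 = r.+1 by lia.
  by rewrite Ea Eb E2 in ca cb; lia.
(* Otherwise column [prow nu r.+1] and the next one, both shared by the two rows, form a square. *)
have thin r : r.+1 < k -> prow nu r.+1 < prow mu r.+2 -> prow mu r.+2 <= (prow nu r.+1).+1.
  move=> rk lt; rewrite leqNgt; apply/negP => gt.
  have cn : prow nu r.+1 < n - k by apply: leq_trans lt (prow_le _ _).
  have := no2 (Ordinal (ltnW rk), Ordinal cn); rewrite /= !inBE ?(ltnW rk) //.
  by have := is_partP _ pn _ rk; have := is_partP _ pm _ rk; lia.
exists (prow mu i.+1).-1, (J - i); split.
  rewrite /ribbon_dom subnKC // Jk /=; have le := prow_le mu i.+1.
  have lei : 0 < i -> prow mu i.+1 <= prow nu i.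
    by case: (i) ik box0 => // i' ik box0 _; rewrite -(box0 i') //; apply: is_partP pm _ _.
  by apply/and3P; split; [lia | lia | apply/implyP => /lei; lia].
move=> r rk; case: ltnP => [/box0 //|ir]; case: eqP => [->|/eqP ri]; first by lia.
rewrite subnKC //; case: leqP => rJ.
  case: r rk ir ri rJ => [|r] rk ir ri rJ; first by lia.
  by apply/eqP; rewrite eqn_leq thin ?join //; lia.
apply/eqP; rewrite eqn_leq nle // andbT leqNgt; apply/negP => lt.
by have := maxJ r; rewrite /B rk lt => /(_ isT); lia.
Qed.

Lemma card_ord_interval N a b : b <= N -> #|[set r : 'I_N | a <= r < b]| = b - a.
Proof.
move=> bN; rewrite cardsE -sum1_card.
rewrite -(big_mkord (fun r => a <= r < b) (fun=> 1)).
rewrite -(@big_nat_widen _ _ _ 0 b N (fun r => a <= r) (fun=> 1)) //.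
rewrite -(@big_nat_widenl _ _ _ a 0 b predT (fun=> 1)) //.
by rewrite sum_nat_const_nat muln1.
Qed.

Section Spec.
Variables (nu mu : part n k) (i e j : nat).
Hypotheses (pn : is_part nu) (dom : ribbon_dom nu i e j) (spec : ribbon_spec nu mu i e j).

Let ijk : i + j < k. Proof. by case/and4P: dom. Qed.
Let ie : prow nu i.+1 <= e. Proof. by case/and4P: dom. Qed.
Let en : e < n - k. Proof. by case/and4P: dom. Qed.
Let ei : 0 < i -> e < prow nu i. Proof. by case/and4P: dom => _ _ _ /implyP. Qed.
Let ik : i < k. Proof. exact: leq_ltn_trans (leq_addr j i) ijk. Qed.

Lemma spec_out r : r < k -> ~~ (i <= r <= i + j) -> prow mu r.+1 = prow nu r.+1.
Proof.
move=> rk out; rewrite spec //; have [//|ir] := ltnP r i.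
have -> : (r == i) = false by lia.
by have -> : (r <= i + j) = false by lia.
Qed.

Lemma spec_head : prow mu i.+1 = e.+1.
Proof. by rewrite spec // ltnn eqxx. Qed.

Lemma spec_in r : i <= r < i + j -> prow mu r.+2 = (prow nu r.+1).+1.
Proof.
move=> ir; rewrite spec; last by lia.
have -> : (r.+1 < i) = false by lia.
have -> : (r.+1 == i) = false by lia.
by have -> : (r.+1 <= i + j) by lia.
Qed.

Lemma spec_box r : r < k -> (prow nu r.+1 < prow mu r.+1) = (i <= r <= i + j).
Proof.
move=> rk; case: (boolP (i <= r <= i + j)) => [|/spec_out -> //]; last by rewrite ltnn.
case/andP; rewrite leq_eqVlt => /orP [/eqP <- _|]; first by rewrite spec_head ltnS.
case: r rk => // r rk ir rj; rewrite spec_in; last by lia.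
by rewrite ltnS; apply: is_partP pn _ _.
Qed.

Lemma spec_sub r : r < k -> prow nu r.+1 <= prow mu r.+1.
Proof.
move=> rk; have := spec_box rk; case: ltnP => [/ltnW //|_ out].
by rewrite spec_out // -out.
Qed.

Lemma spec_part : is_part mu.
Proof.
apply/is_partP => r rk; have mn := is_partP _ pn r rk.
have b1 := spec_box (ltnW rk); have b2 := spec_box rk.
have [lt|ge] := ltnP r.+1 i.
  by rewrite !spec_out //; lia.
move: ge; rewrite leq_eqVlt => /orP [/eqP E|ge].
  have ei' := ei; have hd := spec_head; rewrite E in ei' hd.
  by rewrite hd spec_out; [apply: ei' | lia | lia].
have [rj|jr] := leqP r.+1 (i + j).
  by rewrite spec_in; [move: b1|]; lia.
rewrite [X in X <= _]spec_out //; last by lia.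
by apply: leq_trans mn (spec_sub (ltnW rk)).
Qed.

Lemma spec_head_in : head_in nu mu i.+1.
Proof.
rewrite /head_in has_boxE // spec_box // leqnn leq_addr /=.
apply/forallP => r; apply/implyP; rewrite ltnS => ri.
by rewrite has_boxE // spec_box //; lia.
Qed.

(** Go right while possible, otherwise up: the last box of a row below the head lies under the first
    box of the row above. *)
Lemma spec_connect (z : 'I_k * 'I_(n - k)) : cell_in nu mu z ->
  connect [rel a b | [&& cell_in nu mu a, cell_in nu mu b & adj a b]] z
    (Ordinal ik, Ordinal en).
Proof.
have [m] := ubnP (z.1 * (n - k).+1 + (n - k - z.2)).
elim: m z => // m IH [[r rk] [c cn]] /= lm cz.
have := cz; rewrite /cell_in inBE //= => /andP [nc cm].
have := spec_box rk; rewrite (leq_ltn_trans nc cm) => /esym /andP [ir rj].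
have [lt|ge] := ltnP c.+1 (prow mu r.+1).
  have cn' : c.+1 < n - k by apply: leq_trans lt (prow_le _ _).
  have cz' : cell_in nu mu (Ordinal rk, Ordinal cn') by rewrite /cell_in inBE //=; lia.
  apply: connect_trans (IH _ _ cz'); last by rewrite /=; lia.
  by apply: connect1; rewrite /= cz cz' /adj /= !eqxx.
have Ec : prow mu r.+1 = c.+1 by lia.
move: ir; rewrite leq_eqVlt => /orP [/eqP E|ir].
  have ce : c = e by have := spec_head; rewrite E Ec => -[].
  suff -> : (Ordinal rk, Ordinal cn) = (Ordinal ik, Ordinal en) by [].
  by congr (_, _); apply: val_inj.
case: r rk lm cz nc cm rj ge Ec ir => // r rk lm cz nc cm rj ge Ec ir.
rewrite spec_in in Ec; last by lia.
have rk' := ltnW rk.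
have cz' : cell_in nu mu (Ordinal rk', Ordinal cn).
  rewrite /cell_in inBE //=; have := spec_box rk'.
  by rewrite (_ : (i <= r <= i + j)); lia.
apply: connect_trans (IH _ _ cz'); last by rewrite /=; lia.
by apply: connect1; rewrite /= cz cz' /adj /= !eqxx !orbT.
Qed.

Lemma spec_ribbon : is_ribbon nu mu.
Proof.
apply/and4P; split.
- by apply/forallP => r; have := spec_sub (ltn_ord r); rewrite !prowE.
- apply/existsP; exists (Ordinal ik, Ordinal en).
  by rewrite /cell_in inBE //= spec_head ie ltnSn.
- apply/forallP => z; apply/forallP => z'; apply/implyP => /andP [cz cz'].
  apply: connect_trans (spec_connect cz) _.
  rewrite sym_connect_sym; first exact: spec_connect.
  by move=> a b /=; rewrite /adj; lia.
apply/existsPn => -[[r rk] [c cn]]; apply/negP => /= /and4P [b1 b2 b3 b4].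
have rk' := inB_out b2; rewrite !inBE // in b1 b2 b3 b4.
have s1 := spec_box rk; have s2 := spec_box rk'.
have ir : i <= r < i + j by lia.
by have := spec_in ir; lia.
Qed.

Lemma spec_ht : ht nu mu = j.+1.
Proof.
rewrite /ht (_ : [set r | _] = [set r : 'I_k | i <= r < (i + j).+1]).
  by rewrite card_ord_interval //; lia.
by apply/setP => r; rewrite !inE has_boxE // spec_box.
Qed.

Lemma spec_wd : wd nu mu = e.+1 - prow nu (i + j).+1.
Proof.
rewrite /wd (_ : [set c | _] = [set c : 'I_(n - k) | prow nu (i + j).+1 <= c < e.+1]).
  by rewrite card_ord_interval.
have mono := is_part_mono pn; have mono' := is_part_mono spec_part.
apply/setP => c; rewrite !inE; apply/existsP/idP => [[r]|/andP [ge le]].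
  rewrite inBE // => /andP [nc cm]; have := spec_box (ltn_ord r).
  rewrite (leq_ltn_trans nc cm) => /esym /andP [ir rj].
  by have := mono _ _ rj ijk; have := mono' _ _ ir (ltn_ord r); rewrite spec_head; lia.
(* The first row from the head down whose [nu] part is at most [c] contains column [c]: its [mu]
   part is one more than the preceding [nu] part, which exceeds [c]. *)
have ex : exists r, (i <= r) && (prow nu r.+1 <= c) by exists (i + j); rewrite leq_addr.
have [r /andP [ir rc] rmin] := ex_minnP ex.
have rj : r <= i + j by apply: rmin; rewrite leq_addr.
have rk := leq_ltn_trans rj ijk.
exists (Ordinal rk); rewrite inBE //= rc /=.
move: ir; rewrite leq_eqVlt => /orP [/eqP <-|]; first by rewrite spec_head.
case: r rc rmin rj {rk} => // r rc rmin rj ir; rewrite spec_in; last by lia.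
rewrite ltnS ltnW // ltnNge; apply/negP => lt.
by have := rmin r; rewrite lt -ltnS ir => /(_ isT); lia.
Qed.

End Spec.
End Ribbons.

(** * Effect of a jump on the rows *)

Section Moves.
Local Open Scope nat_scope.
Implicit Types b c : seq bool.

Fixpoint unset b j : seq bool :=
  match b, j with
  | [::], _ => [::]
  | false :: c, _ => false :: unset c j
  | true :: c, 0 => false :: c
  | true :: c, j'.+1 => true :: unset c j'
  end.

(* Moves the [j]-th one to the zero that has [e] zeros to its right. *)
Fixpoint move_one b e j : seq bool :=
  match b with
  | false :: c => if e == zeros c then true :: unset c j else false :: move_one c e j
  | _ => b
  end.

Lemma size_unset b j : size (unset b j) = size b.
Proof. by elim: b j => [|[] b IH] [|j] //=; rewrite IH. Qed.

Lemma zeros_unset b j : j < ones b -> zeros (unset b j) = (zeros b).+1.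
Proof.
by elim: b j => [|[] b IH] [|j] //= lt; rewrite IH //; lia.
Qed.

Lemma rows_unset b j r : j < ones b ->
  nth 0 (rows (unset b j)) r =
  if r < j then (nth 0 (rows b) r).+1 else nth 0 (rows b) r.+1.
Proof.
elim: b j r => [|[] b IH] [|j] r //=; rewrite ?add0n ?add1n => lt.
- by case: r => [|r] /=; rewrite ?zeros_unset // IH.
- by rewrite IH.
by rewrite IH.
Qed.

Lemma size_move_one b e j : size (move_one b e j) = size b.
Proof. by elim: b => [|[] b IH] //=; case: ifP; rewrite /= ?size_unset ?IH. Qed.

Lemma zeros_move_one b e j : j < ones b -> nth 0 (rows b) 0 <= e < zeros b ->
  zeros (move_one b e j) = zeros b.
Proof.
elim: b => [|[] b IH] //= jb.
rewrite ?add1n => lt; case: eqP => [_|ne] /=; first by rewrite zeros_unset.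
by rewrite IH //; lia.
Qed.

(** The moved one becomes the first, and the ones it crosses lose a rank and gain the vacated site
    as a zero on their right: this is the pattern of [ribbon_spec]. *)
Lemma rows_move_one b e j r : j < ones b -> nth 0 (rows b) 0 <= e < zeros b ->
  nth 0 (rows (move_one b e j)) r =
  if r == 0 then e.+1 else if r <= j then (nth 0 (rows b) r.-1).+1 else nth 0 (rows b) r.
Proof.
elim: b => [|[] b IH] //= jb; first by lia.
rewrite ?add1n => lt; case: eqP => [->|ne] /=.
  by case: r {IH} => [|r] /=; rewrite ?zeros_unset // rows_unset.
by rewrite IH //; lia.
Qed.

Lemma rows_last u : last true u -> 0 < ones u -> nth 0 (rows u) (ones u).-1 = 0.
Proof.
elim/last_ind: u => [|u a _] //; rewrite last_rcons => -> _.
rewrite -cats1 count_cat rows_cat nth_cat size_map size_rows /= !addn1 /=.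
by rewrite ltnn subnn.
Qed.

Lemma ones0_nil u : last true u -> ones u = 0 -> u = [::].
Proof.
elim/last_ind: u => [|u a _] //; rewrite last_rcons => ->.
by rewrite -cats1 count_cat /= !addn1.
Qed.

End Moves.

(** * Jumps as explicit sums *)

Section JumpSum.
Variables (F : fieldType) (V : lmodType F) (p q hbar : F) (tau : nat -> F).
Implicit Types (b c : seq bool) (y : seq bool -> V).

Lemma remove_one_sum b y : remove_one p q b y =
  \sum_(j < ones b) (p ^+ j * q ^+ (zeros b - nth 0%N (rows b) j)) *: y (unset b j).
Proof.
elim: b y => [|[] b IH] y /=; first by rewrite big_ord0.
  rewrite ?add1n big_ord_recl /= ?add0n subnn mulr1 scale1r; congr (_ + _).
  rewrite IH scaler_sumr; apply: eq_bigr => j _.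
  by rewrite /= scalerA mulrA -exprS.
rewrite ?add0n IH scaler_sumr; apply: eq_bigr => j _.
rewrite scalerA mulrCA -exprS ?add1n subSn //; exact: nth_rows_le.
Qed.

(** Only holes precede the first one, so the landing hole with [e] zeros to its right is at distance
    [zeros b - e - 1] from the start. *)
Lemma jump_sum s b y : has id b -> jump p q hbar tau s b y =
  tau (s + (zeros b - nth 0%N (rows b) 0))%N *: y b +
  \sum_(nth 0%N (rows b) 0 <= e < zeros b) \sum_(j < ones b)
    ((hbar - (p - q) * tau (s + (zeros b - e.+1))%N) * p ^+ j
       * q ^+ (e - nth 0%N (rows b) j)) *: y (move_one b e j).
Proof.
elim: b s y => [|[] b IH] s y //= hb.
  by rewrite ?add0n subnn addn0 big_geq // addr0.
have le := nth_rows_le b 0.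
rewrite IH // ?add1n ?add0n subSn // addnS big_nat_recr //= addrA; congr (_ + _ + _).
  apply: eq_big_nat => e /andP [ge lt]; apply: eq_bigr => j _ /=.
  by rewrite ltn_eqF // subSS (_ : s.+1 + _ = s + (zeros b - e))%N //; lia.
rewrite remove_one_sum scaler_sumr; apply: eq_bigr => j _.
by rewrite eqxx subnn addn0 scalerA mulrA.
Qed.

End JumpSum.

(** * Jumps as additions of ribbons *)

Section Ribbon_jump.
Variables (F : fieldType) (V : lmodType F) (n k : nat) (p q hbar : F) (t : nat -> F).
Variable (Y : 'S_n -> V).
Hypothesis kn : (k <= n)%N.

Lemma prow_part_of b r : config n k b -> (r < k)%N ->
  prow (part_of n k b) r.+1 = nth 0%N (rows b) r.
Proof. by move=> cb rk; rewrite (prowE _ (Ordinal rk)) part_ofE. Qed.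

Let y c := if config n k c then Ynu p Y (part_of n k c) else 0.

(** Landing hole [e] and source [j] parametrize the ribbons with the given head row. The particles
    crossed number the height minus one, the holes crossed the width minus one. *)
Theorem R_val_jump u c : last true u -> config n k (u ++ c) -> has id c ->
  R_val p q hbar t Y (ones u).+1 (part_of n k (u ++ c)) =
  jump p q hbar (fun s => t (n - s)%N) (size u) c (fun c' => y (u ++ c')).
Proof.
move=> lu cb hc; rewrite jump_sum // /R_val /y cb.
have [sz ob zb] := configP kn cb; rewrite size_cat in sz.
rewrite count_cat in ob; rewrite count_cat in zb.
have oc : (0 < ones c)%N by rewrite -has_count.
set i := ones u; set nu := part_of n k (u ++ c).
have ou : (ones u + zeros u)%N = size u := ones_zeros u.
have ik : (i < k)%N by rewrite /i; lia.
have pn : is_part nu by apply: is_part_of.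
have nu_c r : (r < ones c)%N -> prow nu (i + r).+1 = nth 0%N (rows c) r.
  move=> rc; rewrite prow_part_of //; last by rewrite /i; lia.
  by rewrite rows_cat nth_cat size_map size_rows ltnNge leq_addr addKn.
have nu_i : prow nu i.+1 = nth 0%N (rows c) 0 by rewrite -nu_c // addn0.
have nu_u r : (r < i)%N -> prow nu r.+1 = (nth 0%N (rows u) r + zeros c)%N.
  move=> ri; rewrite prow_part_of; [|by []|by lia].
  by rewrite rows_cat nth_cat size_map size_rows ri (nth_map 0%N) ?size_rows.
(* The prefix ends with a particle, so the part above the head row counts the holes of [c]; the
   bound on [e] in [ribbon_dom] thus says that the landing hole lies in [c]. *)
have nu_last : (0 < i)%N -> prow nu i = zeros c.
  move=> i0; have := nu_u i.-1; rewrite prednK // => ->; last by lia.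
  by rewrite rows_last.
have zc : (zeros c <= n - k)%N by lia.
congr (_ *: _ + _).
  congr t; rewrite nu_i; have := nth_rows_le c 0; rewrite /i; lia.
pose g (ej : 'I_(n - k) * 'I_k) := part_of n k (u ++ move_one c ej.1 ej.2).
pose Q (ej : 'I_(n - k) * 'I_k) := ribbon_dom nu i ej.1 ej.2.
have domE e j : ribbon_dom nu i e j =
    (nth 0%N (rows c) 0 <= e < zeros c)%N && (j < ones c)%N.
  rewrite /ribbon_dom nu_i; apply/and4P/andP.
    case=> ijk le en /implyP ei; split; last by rewrite /i in ijk; lia.
    rewrite le /=; have [i0|i0] := posnP i; last by rewrite -nu_last ?ei.
    by rewrite (ones0_nil lu i0) /= in zb; lia.
  case=> /andP [le lt] jc; split=> //; [by rewrite /i; lia | by lia|].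
  by apply/implyP => /nu_last ->.
have cfg e j : ribbon_dom nu i e j -> config n k (u ++ move_one c e j).
  rewrite domE => /andP [le jc].
  have zm := zeros_move_one jc le; have := ones_zeros (move_one c e j).
  have := ones_zeros c; rewrite size_move_one zm => E1 E2.
  by rewrite /config size_cat count_cat size_move_one; lia.
have spec e j : ribbon_dom nu i e j ->
    ribbon_spec nu (part_of n k (u ++ move_one c e j)) i e j.
  move=> dm r rk; rewrite prow_part_of ?cfg // rows_cat nth_cat size_map size_rows.
  move: (dm); rewrite domE => /andP [le jc]; have [ri|ir] := ltnP r i.
    by rewrite (nth_map 0%N) ?size_rows // nu_u // zeros_move_one.
  rewrite rows_move_one // -/i subn_eq0.
  have [->|ne] := eqVneq r i; first by rewrite leqnn.
  have -> : (r <= i)%N = false by lia.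
  rewrite leq_subLR; case: leqP => rj.
    have -> : prow nu r = prow nu (i + (r - i).-1).+1 by congr prow; lia.
    by rewrite nu_c //; lia.
  have -> : prow nu r.+1 = prow nu (i + (r - i)).+1 by congr (prow _ _.+1); lia.
  by rewrite nu_c //; rewrite /i in ir rj ne *; lia.
have PE mu : [&& is_part mu, is_ribbon nu mu & head_in nu mu i.+1] = (mu \in g @: [set ej | Q ej]).
  apply/idP/imsetP => [/(ribbon_specP pn ik) [e [j [dm sp]]]|[[e j]]].
    have en : (e < n - k)%N by case/and4P: dm.
    have jk : (j < k)%N by case/and4P: dm; lia.
    exists (Ordinal en, Ordinal jk); first by rewrite inE.
    by apply: prow_eqP => r rk; rewrite (sp r rk) (spec _ _ dm r rk).
  rewrite inE /Q /= => dm ->; have sp := spec _ _ dm.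
  by rewrite (spec_part pn dm sp) (spec_ribbon pn dm sp) (spec_head_in pn dm sp).
(* The parametrization is injective: [e] is read off the head row and [j] off the height. *)
rewrite (eq_bigl _ _ PE) big_imset /=; last first.
  move=> [e j] [e' j']; rewrite !inE /Q /= => dm dm' E.
  have sp := spec _ _ dm; have sp' := spec _ _ dm'.
  rewrite /g /= in E; rewrite -E in sp'.
  have := spec_head dm sp; rewrite (spec_head dm' sp') => -[/val_inj Ee].
  have := spec_ht pn dm sp; rewrite (spec_ht pn dm' sp') => -[/val_inj Ej].
  by rewrite Ee Ej.
pose f e j := ((hbar - (p - q) * t (n - (size u + (zeros c - e.+1)))%N) * p ^+ j
   * q ^+ (e - nth 0%N (rows c) j)) *: y (u ++ move_one c e j).
transitivity (\sum_(nth 0%N (rows c) 0 <= e < zeros c) \sum_(j < ones c) f e j) => //.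
rewrite (@big_nat_widenl _ _ _ _ 0) // (@big_nat_widen _ _ _ 0 _ (n - k)) // big_mkord.
under [RHS]eq_bigr => e _.
  rewrite (big_ord_widen k (f e)); last by lia.
  over.
rewrite pair_big /=; apply: eq_big => [[e j]|[e j]].
  by rewrite !inE /Q /= domE.
rewrite inE /Q /= => dm; have sp := spec _ _ dm.
rewrite /f /y cfg // (spec_head dm sp) (spec_ht pn dm sp) (spec_wd pn dm sp) /=.
move: (dm); rewrite domE => /andP [le jc].
congr ((_ * _ * _) *: _).
  by congr (_ - _ * t _); rewrite /i; lia.
by congr (_ ^+ _); rewrite nu_c //; lia.
Qed.

End Ribbon_jump.

(** * Generating functions *)

Section GeneratingFunction.
Variables (F : fieldType) (V : lmodType F).

(** Every factor is either skipped or applied, and filtering keeps the order of [l], which matters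
    since the [f i] need not commute. *)
Lemma foldl_subsets (I : finType) (f : I -> V -> V) (z : F) (l : seq I) v :
  uniq l -> (forall i, lin (f i)) ->
  foldl (fun u i => u + z *: f i u) v l =
  \sum_(S : {set I} | S \subset l)
    z ^+ #|S| *: foldl (fun u i => f i u) v [seq i <- l | i \in S].
Proof.
move=> + lf; elim: l v => [|a l IH] v /=.
  move=> _; rewrite (big_pred1 set0) ?cards0 ?scale1r // => S.
  by rewrite /= -subset0; apply: eq_subset_r => i; rewrite inE.
case/andP=> al ul; rewrite IH //.
pose L (S : {set I}) v := foldl (fun u i => f i u) v [seq i <- l | i \in S].
have lL S : lin (L S) by apply: lin_foldl => i _.
rewrite (eq_bigr (fun S : {set I} => z ^+ #|S| *: L S v + (z ^+ #|S| * z) *: L S (f a v))); last first.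
  by move=> S _; rewrite -/(L S _) (linD (lL S)) (linZ (lL S)) scalerDr scalerA.
rewrite big_split [RHS](bigID (fun S : {set I} => a \notin S)) /=; congr (_ + _).
  apply: eq_big => [S|S /subsetP Sl].
    apply/subsetP/andP => [Sl|[/subsetP Sl aS] i iS].
      split; last by apply: contra al => /Sl.
      by apply/subsetP => i /Sl il; rewrite inE il orbT.
    have := Sl i iS; rewrite inE => /orP [/eqP E|//].
    by rewrite -E iS in aS.
  by rewrite ifN //; apply: contra al => /Sl.
rewrite [RHS](reindex_onto (fun S => a |: S) (fun S => S :\ a)); last first.
  by move=> S /andP [_ /negPn aS]; rewrite setD1K.
have notin (S : {set I}) : S \subset l -> a \notin S.
  by move=> /subsetP Sl; apply: contra al => /Sl.
apply: eq_big => [S|S /[dup] /subsetP Sl /notin aS].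
  rewrite setU11 andbT; apply/idP/andP => [Sl|[/subsetP Sl /eqP E]].
    split; last by rewrite setU1K // notin.
    apply/subsetP => i; rewrite !inE => /orP [-> //|/(subsetP Sl) ->].
    by rewrite orbT.
  apply/subsetP => i iS; have : i \in a |: S by rewrite inE iS orbT.
  move/Sl; rewrite inE => /orP [/eqP ia|//].
  by move: iS; rewrite -E ia !inE eqxx.
rewrite setU11 cardsU1 aS add1n -exprSr /=; congr (_ *: foldl _ _ _).
apply: eq_in_filter => i il; rewrite in_setU1.
by case: (i =P a) => // ia; rewrite -ia il in al.
Qed.

Lemma esym_apply_gen (f : nat -> V -> V) k (z : F) v :
  (forall i, (0 < i <= k)%N -> lin (f i)) ->
  \sum_(r < k.+1) z ^+ r *: esym_apply f k r v =
  foldl (fun u i => u + z *: f i u) v (iota 1 k).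
Proof.
move=> lf; pose g (i : 'I_k) := f i.+1.
have -> : iota 1 k = [seq (nat_of_ord i).+1 | i <- enum 'I_k].
  by rewrite (iotaDl 1 0) -val_enum_ord -map_comp; apply: eq_map.
have foldl_map' (h : nat -> V -> V) (l : seq 'I_k) u :
    foldl (fun u i => h i u) u [seq (nat_of_ord i).+1 | i <- l] =
    foldl (fun u i => h (nat_of_ord i).+1 u) u l.
  by elim: l u => //= i l IH u; rewrite IH.
rewrite (foldl_map' (fun i u => u + z *: f i u)) (@foldl_subsets _ g).
- rewrite /esym_apply; under eq_bigr => r _ do rewrite scaler_sumr.
  rewrite (exchange_big_dep predT) //=; apply: eq_big => [S|S _].
    by apply/esym/subsetP => i _; rewrite mem_enum.
  have Sk : (#|S| < k.+1)%N by rewrite ltnS -[k in (_ <= k)%N]card_ord max_card.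
  rewrite (big_pred1 (Ordinal Sk)); last by move=> r /=; rewrite -[RHS]val_eqE eq_sym.
  rewrite foldl_map' /=; congr (_ *: foldl _ _ _).
  by rewrite enumT {1}/enum_mem.
- exact: enum_uniq.
by move=> i; apply: lf; rewrite ltn_ord.
Qed.

(** In each coordinate this is a polynomial of size at most [m] with the roots [0, ..., m - 1],
    distinct by characteristic zero. *)
Lemma vector_poly_eq0 (J : finType) (Y : J -> V) m (a : nat -> V) :
  [pchar F] =i pred0 ->
  (forall c : J -> F, \sum_j c j *: Y j = 0 -> forall j, c j = 0) ->
  (forall v, exists c : J -> F, v = \sum_j c j *: Y j) ->
  (forall z : F, \sum_(r < m) z ^+ r *: a r = 0) ->
  forall r, (r < m)%N -> a r = 0.
Proof.
move=> ch free span H r rm.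
have [c ac] := fin_all_exists (fun r : 'I_m => span (a r)).
suff c0 j : c (Ordinal rm) j = 0.
  by rewrite (ac (Ordinal rm)) big1 // => j _; rewrite c0 scale0r.
pose P := \poly_(r < m) (oapp (fun r => c r j) 0 (insub r : option 'I_m)).
have PE z : P.[z] = \sum_(r < m) z ^+ r * c r j.
  rewrite horner_poly; apply: eq_bigr => r' _.
  by rewrite valK /= mulrC.
suff P0 : P = 0.
  by have := coef0 F r; rewrite -P0 coef_poly rm (insubT (fun r => r < m)%N rm).
apply: (@roots_geq_poly_eq0 _ _ [seq i%:R | i <- iota 0 m]).
- apply/allP => z _; rewrite /root PE; apply/eqP.
  move: j {P PE}; apply: free; rewrite -[RHS](H z).
  under eq_bigr => j _ do rewrite scaler_suml.
  rewrite exchange_big; apply: eq_bigr => r' _; rewrite ac scaler_sumr.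
  by apply: eq_bigr => j _; rewrite scalerA.
- rewrite map_inj_uniq ?iota_uniq // => i i'.
  move/pcharf0P: ch => ch.
  wlog le : i i' / (i <= i')%N => [W E|/eqP].
    by have [/W->//|/ltnW /W ->] := leqP i i'.
  rewrite eq_sym -subr_eq0 -natrB // ch subn_eq0 => le'.
  by apply/eqP; rewrite eqn_leq le.
by rewrite size_map size_iota size_poly.
Qed.

End GeneratingFunction.

(** * Every partition comes from a configuration *)

Section FromPartition.
Local Open Scope nat_scope.

(** [M] counts the zeros still to be written; a part [a] leaves exactly [a] of them after its
    one. *)
Fixpoint bits_of (l : seq nat) (M : nat) : seq bool :=
  if l is a :: l' then nseq (M - a) false ++ true :: bits_of l' a else nseq M false.

Lemma bits_ofP l M : path geq M l ->
  [/\ zeros (bits_of l M) = M, ones (bits_of l M) = size l & rows (bits_of l M) = l].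
Proof.
have rz g : rows (nseq g false) = [::] by elim: g.
elim: l M => [|a l IH] M /=; first by rewrite !count_nseq rz /= mul1n mul0n.
case/andP=> aM /IH [z1 o1 r1]; rewrite !count_cat !count_nseq rows_cat rz /= z1 o1 r1.
by split=> //; lia.
Qed.

Lemma part_of_surj n k (lam : part n k) : k <= n -> is_part lam ->
  exists2 b, config n k b & part_of n k b = lam.
Proof.
move=> kn pl; pose l := [seq prow lam r.+1 | r <- iota 0 k].
have pth : path geq (n - k) l.
  apply/(pathP 0) => r; rewrite size_map size_iota => rk.
  rewrite [nth 0 l r](nth_map 0) ?size_iota // nth_iota //.
  case: r rk => [|r] rk; first exact: prow_le.
  rewrite /= (nth_map 0) ?size_iota ?nth_iota ?(ltnW rk) //.
  exact: (is_partP _ pl).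
have [zb ob rb] := bits_ofP pth; rewrite size_map size_iota in ob.
have cb : config n k (bits_of l (n - k)).
  by rewrite /config ob eqxx -ones_zeros ob zb; lia.
exists (bits_of l (n - k)) => //; apply: prow_eqP => r rk.
by rewrite prow_part_of // rb (nth_map 0) ?size_iota // nth_iota.
Qed.

End FromPartition.

Theorem theorem5p1 (F : fieldType) (V : lmodType F) (n k : nat)
    (p q hbar : F) (t : nat -> F) (T x : nat -> V -> V)
    (Y : 'S_n -> V) (ev : V -> F) :
  [pchar F] =i pred0 ->
  (k <= n)%N ->
  schubert_rep p q hbar t T x Y ev ->
  forall R : nat -> V -> V,
  (forall i, (0 < i <= k)%N -> lin (R i)) ->
  (forall i, (0 < i <= k)%N -> forall nu : part n k, is_part nu ->
      R i (Ynu p Y nu) = R_val p q hbar t Y i nu) ->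
  forall lam : part n k, is_part lam ->
  forall r, (r <= k)%N ->
  esym_apply x k r (Ynu p Y lam) = esym_apply R k r (Ynu p Y lam).
Proof.
move=> ch kn rep R lR Rv lam pl r rk.
have lx i : (0 < i <= k)%N -> lin (x i) by move=> ik; apply: (x_lin rep); lia.
apply/eqP; rewrite -subr_eq0; apply/eqP.
apply: (vector_poly_eq0 (m := k.+1)
  (a := fun r => esym_apply x k r (Ynu p Y lam) - esym_apply R k r (Ynu p Y lam))
  ch (Y_free rep) (Y_span rep)) => // z.
under eq_bigr => i _ do rewrite scalerBr.
rewrite sumrB !esym_apply_gen //; apply/eqP; rewrite subr_eq0; apply/eqP.
have [b cb <-] := part_of_surj kn pl; have [sz ob _] := configP kn cb.
have := gen_op_Ynu kn rep z cb; rewrite /gen_op => E.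
have -> : foldl (fun u i => u + z *: x i u) (Ynu p Y (part_of n k b)) (iota 1 k) =
   foldl (fun u i => u + z *: x i.+1 u) (Ynu p Y (part_of n k b)) (iota 0 k).
  rewrite (iotaDl 1 0).
  by elim: (iota 0 k) (Ynu _ _ _) => //= i l IH v; rewrite add1n IH.
pose y c := if config n k c then Ynu p Y (part_of n k c) else 0.
have yb : y b = Ynu p Y (part_of n k b) by rewrite /y cb.
rewrite {}E -yb.
(* Nothing is settled before the first factor acts, so the prefix is empty. *)
have := @prod_R_transfer F V p q hbar z (fun s => t (n - s)%N) n k R y [::] b lR.
rewrite /= ob => -> // u c lu szc obc hc.
have cc : config n k (u ++ c) by rewrite /config szc obc !eqxx.
rewrite -R_val_jump // -Rv; [by rewrite /y cc| |exact: is_part_of].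
by rewrite count_cat in obc; rewrite has_count in hc; lia.
Qed.
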